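(* Let $(\mathfrak g,W)$ be a definable $\mathfrak g$-module of finite dimension. Assume that $\mathfrak g$ is abelian, that $W$ is $\mathfrak g$-minimal, and that the action is not almost trivial. Then there exists a definable field $K$ such that $W/W_0\simeq K^+$ for a finite $\mathfrak g$-submodule $W_0$ of $W$, and $\mathfrak g/\mathfrak g_0$ embeds in $K^+\cdot\mathrm{Id}$ for a definable ideal $\mathfrak g_0$ of infinite index in $\mathfrak g$. Consequently there are no proper (nonzero) $\mathfrak g$-submodules in $W/W_0$.
   Context: A first-order theory $T$ is finite-dimensional if there is a function $\dim$ from the class of all interpretable sets in models of $T$ to $\omega\cup\{-\infty\}$ such that, for every formula $\varphi(x,y)$, all interpretable sets $X,Y$ and every interpretable function $f:X\to Y$: (1) if $a,a'$ have the same type over $\emptyset$ then $\dim\varphi(x,a)=\dim\varphi(x,a')$; (2) $\dim\emptyset=-\infty$, and $\dim X=0$ iff $X$ is finite (nonempty); (3) $\dim(X\cup Y)=\max\{\dim X,\dim Y\}$; (4) if $\dim f^{-1}(y)\ge k$ for all $y\in Y$ then $\dim X\ge \dim Y+k$; (5) if $\dim f^{-1}(y)\le k$ for all $y\in Y$ then $\dim X\le\dim Y+k$. A definable module ''of finite dimension'' is one where the Lie ring, the module and the action are definable in (a model of) a finite-dimensional theory. A Lie ring is an abelian group $(\mathfrak g,+)$ with a biadditive antisymmetric bracket satisfying the Jacobi identity. A $\mathfrak g$-module is an abelian group $W$ with a biadditive action such that $[g,g']w=g(g'w)-g'(gw)$. $W$ is $\mathfrak g$-minimal if it has no infinite definable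 $\mathfrak g$-invariant subgroup of infinite index. $\widetilde C_{\mathfrak g}(W)=\{g\in\mathfrak g:|W:C_W(g)|<\infty\}$ with $C_W(g)=\{w: gw=0\}$; the action is almost trivial if $\widetilde C_{\mathfrak g}(W)$ has finite index in $\mathfrak g$. ''Embeds in $K^+\cdot \mathrm{Id}$'' means that $\mathfrak g/\mathfrak g_0$ acts faithfully on $W/W_0\simeq K^+$ by multiplication by elements of $K$. *)

(* Defs.v *)
From HB Require Import structures.
From mathcomp Require Import all_boot all_order all_algebra.
From mathcomp Require Import boolp classical_sets functions cardinality.
Set Implicit Arguments.
Unset Strict Implicit.
Unset Printing Implicit Defensive.
Import GRing.Theory.
Local Open Scope classical_set_scope.
Local Open Scope ring_scope.

(******************************************************************************)
(*                              First-order logic                             *)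
(******************************************************************************)

Record signature := Signature {
  fun_sym : Type;
  fun_ar : fun_sym -> nat;
  rel_sym : Type;
  rel_ar : rel_sym -> nat }.

Inductive term (L : signature) (V : Type) :=
  | Var (v : V)
  | App (f : fun_sym L) (t : 'I_(fun_ar f) -> term L V).

(* The free variables of a formula are indexed by V; a quantifier binds the   *)
(* variable None of its body.                                                 *)
Inductive formula (L : signature) (V : Type) :=
  | Equal (t u : term L V)
  | Rel (r : rel_sym L) (t : 'I_(rel_ar r) -> term L V)
  | Not (p : formula L V)
  | And (p q : formula L V)
  | Exists (p : formula L (option V)).

Definition sentence L := formula L void.

Record structure (L : signature) := Structure {
  carrier :> Type;
  carrier_inhabited : inhabited carrier;
  fun_int : forall f : fun_sym L, ('I_(fun_ar f) -> carrier) -> carrier;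
  rel_int : forall r : rel_sym L, ('I_(rel_ar r) -> carrier) -> Prop }.

Fixpoint eval L (M : structure L) V (v : V -> M) (t : term L V) : M :=
  match t with
  | Var x => v x
  | App f ts => fun_int (fun i => eval v (ts i))
  end.

Definition extend (A V : Type) (x : A) (v : V -> A) (o : option V) : A :=
  if o is Some y then v y else x.

Fixpoint sat L (M : structure L) V (v : V -> M) (p : formula L V) : Prop :=
  match p with
  | Equal t u => eval v t = eval v u
  | Rel r ts => rel_int (fun i => eval v (ts i))
  | Not q => ~ sat v q
  | And q r => sat v q /\ sat v r
  | Exists q => exists x : M, sat (extend x v) q
  end.

Definition models L (M : structure L) (T : set (sentence L)) : Prop :=
  forall p, T p -> sat (fun v : void => match v return M with end) p.

Definition same_type L (M N : structure L) V (a : V -> M) (b : V -> N) : Prop :=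
  forall p : formula L V, sat a p <-> sat b p.

(******************************************************************************)
(*                        Definable and interpretable sets                    *)
(******************************************************************************)

Definition join (A U V : Type) (x : U -> A) (y : V -> A) (i : U + V) : A :=
  match i with inl u => x u | inr v => y v end.

(* Definability is with parameters.                                           *)
Definition definable L (M : structure L) V (X : set (V -> M)) : Prop :=
  exists (k : nat) (p : formula L (V + 'I_k)) (a : 'I_k -> M),
    X = [set x | sat (join x a) p].

Definition equiv_on A (D : set A) (E : A -> A -> Prop) : Prop :=
  [/\ forall x, D x -> E x x,
      forall x y, D x -> D y -> E x y -> E y x
    & forall x y z, D x -> D y -> D z -> E x y -> E y z -> E x z].

Definition classes A (D : set A) (E : A -> A -> Prop) : set (set A) :=
  [set [set y | D y /\ E x y] | x in D].

(* The set D_a / E_a, where D_a and E_a are defined by the formulas d(x, a)   *)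
(* and e(x, x', a).                                                           *)
Definition def_dom L n k (d : formula L ('I_n + 'I_k)) (M : structure L)
    (a : 'I_k -> M) : set ('I_n -> M) :=
  [set x | sat (join x a) d].

Definition def_rel L n k (e : formula L ('I_n + 'I_n + 'I_k)) (M : structure L)
    (a : 'I_k -> M) (x y : 'I_n -> M) : Prop :=
  sat (join (join x y) a) e.

Definition def_quot L n k (d : formula L ('I_n + 'I_k))
    (e : formula L ('I_n + 'I_n + 'I_k)) (M : structure L) (a : 'I_k -> M) :
    set (set ('I_n -> M)) :=
  classes (def_dom d a) (def_rel e a).

(* An element of an interpretable set is an equivalence class of tuples, so   *)
(* an interpretable set is a set of sets of tuples. Definable sets correspond *)
(* to quotients by equality.                                                  *)
Definition interpretable L (M : structure L) n (X : set (set ('I_n -> M))) :=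
  exists k (d : formula L ('I_n + 'I_k)) (e : formula L ('I_n + 'I_n + 'I_k))
    (a : 'I_k -> M),
    equiv_on (def_dom d a) (def_rel e a) /\ X = def_quot d e a.

Definition interpretable_fun L (M : structure L) n m
    (X : set (set ('I_n -> M))) (Y : set (set ('I_m -> M)))
    (f : set ('I_n -> M) -> set ('I_m -> M)) : Prop :=
  (forall c, X c -> Y (f c)) /\
  definable [set z : 'I_n + 'I_m -> M |
    exists c, [/\ X c, c (z \o inl) & f c (z \o inr)]].

(******************************************************************************)
(*                          Finite-dimensional theories                       *)
(******************************************************************************)

(* Dimensions live in omega extended with -oo, the latter encoded as None.    *)
Definition dimension := option nat.

Definition dim_le (d e : dimension) : bool :=
  match d, e with
  | None, _ => true
  | Some _, None => false
  | Some m, Some n => (m <= n)%N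
  end.

Definition dim_max (d e : dimension) : dimension := if dim_le d e then e else d.

Definition dim_add (d : dimension) (k : nat) : dimension := omap (addn^~ k) d.

(* Only the values of dim at interpretable sets of models of T matter.        *)
Definition dim_function L :=
  forall (M : structure L) (n : nat), set (set ('I_n -> M)) -> dimension.

Definition dim_invariant L (T : set (sentence L)) (dim : dim_function L) :=
  forall M N : structure L, models M T -> models N T ->
  forall n k (d : formula L ('I_n + 'I_k)) (e : formula L ('I_n + 'I_n + 'I_k))
    (a : 'I_k -> M) (b : 'I_k -> N),
    equiv_on (def_dom d a) (def_rel e a) -> same_type a b ->
    dim M n (def_quot d e a) = dim N n (def_quot d e b).

Definition dim_algebraic L (T : set (sentence L)) (dim : dim_function L) :=
  forall M : structure L, models M T -> forall n (X : set (set ('I_n -> M))),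
    interpretable X ->
    (X = set0 -> dim M n X = None) /\
    (dim M n X = Some 0%N <-> finite_set X /\ X !=set0).

Definition dim_union L (T : set (sentence L)) (dim : dim_function L) :=
  forall M : structure L, models M T -> forall n (X Y : set (set ('I_n -> M))),
    interpretable X -> interpretable Y -> interpretable (X `|` Y) ->
    dim M n (X `|` Y) = dim_max (dim M n X) (dim M n Y).

Definition dim_fibration L (T : set (sentence L)) (dim : dim_function L) :=
  forall M : structure L, models M T ->
  forall n m (X : set (set ('I_n -> M))) (Y : set (set ('I_m -> M))) f (k : nat),
    interpretable X -> interpretable Y -> interpretable_fun X Y f ->
    ((forall y, Y y -> dim_le (Some k) (dim M n (X `&` f @^-1` [set y]))) ->
       dim_le (dim_add (dim M m Y) k) (dim M n X)) /\
    ((forall y, Y y -> dim_le (dim M n (X `&` f @^-1` [set y])) (Some k)) ->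
       dim_le (dim M n X) (dim_add (dim M m Y) k)).

Definition is_dimension L (T : set (sentence L)) (dim : dim_function L) :=
  [/\ dim_invariant T dim, dim_algebraic T dim, dim_union T dim
    & dim_fibration T dim].

Definition finite_dimensional L (T : set (sentence L)) : Prop :=
  exists dim : dim_function L, is_dimension T dim.

(******************************************************************************)
(*                    Algebraic structures definable in M                     *)
(******************************************************************************)

(* An identification of A with an interpretable set of M: code x is the class *)
(* of tuples representing x.                                                  *)
Record coding L (M : structure L) (A : Type) := Coding {
  arity : nat;
  code : A -> set ('I_arity -> M);
  code_inj : injective code;
  code_interpretable : interpretable (range code) }.

Arguments code {L M A} c x _.

Definition definable_set L (M : structure L) A (cA : coding M A) (X : set A) :=
  definable [set z : 'I_(arity cA) -> M | exists x, X x /\ code cA x z].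

Definition definable_map L (M : structure L) A B
    (cA : coding M A) (cB : coding M B) (f : A -> B) :=
  definable [set z : 'I_(arity cA) + 'I_(arity cB) -> M |
    exists x, code cA x (z \o inl) /\ code cB (f x) (z \o inr)].

Definition definable_op L (M : structure L) A B C
    (cA : coding M A) (cB : coding M B) (cC : coding M C) (f : A -> B -> C) :=
  definable [set z : 'I_(arity cA) + 'I_(arity cB) + 'I_(arity cC) -> M |
    exists x y, [/\ code cA x (z \o inl \o inl), code cB y (z \o inl \o inr)
                  & code cC (f x y) (z \o inr)]].

Definition biadditive (A B C : zmodType) (f : A -> B -> C) : Prop :=
  (forall x, {morph f x : y z / y + z}) /\
  (forall y, {morph f^~ y : x z / x + z}).

Definition lie_bracket (g : zmodType) (br : g -> g -> g) : Prop :=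
  [/\ biadditive br,
      forall x y, br x y = - br y x
    & forall x y z, br x (br y z) + br y (br z x) + br z (br x y) = 0].

Definition lie_action (g W : zmodType) (br : g -> g -> g) (act : g -> W -> W) :=
  biadditive act /\
  forall x y w, act (br x y) w = act x (act y w) - act y (act x w).

Definition finite_index (A : zmodType) (B : set A) : Prop :=
  finite_set (range (fun x : A => [set x + b | b in B])).

Definition submodule (g W : zmodType) (act : g -> W -> W) (U : {pred W}) :=
  forall x w, w \in U -> act x w \in U.

Definition lie_ideal (g : zmodType) (br : g -> g -> g) (I : {pred g}) :=
  forall x y, y \in I -> br x y \in I.

Definition minimal_module L (M : structure L) (g W : zmodType)
    (cW : coding M W) (act : g -> W -> W) : Prop :=
  forall U : zmodClosed W, submodule act U -> definable_set cW [set` U] ->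
    finite_set [set` U] \/ finite_index [set` U].

Definition almost_centralizer (g W : zmodType) (act : g -> W -> W) : set g :=
  [set x | finite_index [set w | act x w = 0]].

Definition almost_trivial (g W : zmodType) (act : g -> W -> W) : Prop :=
  finite_index (almost_centralizer act).

Notation "{ 'quot' I }" := (@Quotient.quot _ I) : type_scope.

Definition quot_submodule (g W : zmodType) (act : g -> W -> W)
    (W0 : zmodClosed W) (N : {pred {quot W0}}) : Prop :=
  forall x w, \pi_{quot W0}%qT w \in N -> \pi_{quot W0}%qT (act x w) \in N.

(* Main.v *)
(** Call an element x of g almost zero if its kernel on W has finite index, and
    let W0 be the set of all w killed by some x that is not almost zero. By
    minimality such an x has a finite kernel, and every finite subset of W0 lies
    in one such kernel. If W0 were infinite, there would be arbitrarily long
    chains of uniformly definable kernels with arbitrarily large indices; in an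
    ultrapower of M these become chains with infinite indices, along which the
    dimension grows at each step. So W0 is finite, hence definable; g0 is the
    set of all x with x W in W0, and every x outside g0 is injective on W/W0.
    The same argument, applied to the images x W, shows that it is surjective.

    Let N be a submodule properly containing W0, V a sum of finitely many g v
    with v in N, of maximal dimension, and V' = V + W0. Maximality, applied to V
    and to x V, makes {y | y v in V'} of finite index in g whenever x v lies in N
    for some x outside g0; those v form a definable submodule, hence all of W.
    Computing the dimension of {(y, v) | y v in V'} along both projections gives
    dim V' = dim W. Hence N has finite index, and so N = W.

    Thus W/W0 is a simple module over the commutative ring R generated by g,
    hence a copy of a field, with multiplication (r w1) * v = r v. It is
    definable because, W being covered by finitely many cosets of V', finitely
    many definable families of elements of R suffice. *)

Require Import Defs.
From HB Require Import structures.
From mathcomp Require Import all_boot all_order all_algebra.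
From mathcomp Require Import boolp classical_sets functions cardinality filter.
Set Implicit Arguments.
Unset Strict Implicit.
Unset Printing Implicit Defensive.
Import GRing.Theory.
Local Open Scope classical_set_scope.
Local Open Scope ring_scope.
Local Open Scope quotient_scope.

(** * Definable sets *)

(** In [M] itself every index in the chains is finite, so no dimension changes along them, and
    finite index is not a first-order condition on the parameter. This is why the dimension must
    live on all models of [T]: in the ultrapower the length of the chain stays fixed while the
    indices become infinite. Only dimensions are computed there; minimality is a hypothesis about
    [M], and the module is never transferred. The finiteness of [W0] has to come early, because it
    is what makes [g0] definable. No connected component is used: its part is played by the fact
    that a subset of [g] of finite index never lies inside [g0], so that finitely many conditions of
    finite index can be met by an element outside [g0]. Simplicity is needed for submodules such as
    [R w], sums of unboundedly many terms, whereas minimality speaks of definable submodules only. A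
    span of maximal dimension is the definable substitute for such a submodule. *)

Fixpoint trename L V V' (f : V -> V') (t : term L V) : term L V' :=
  match t with
  | Var x => Var L (f x)
  | App h ts => App (fun i => trename f (ts i))
  end.

Fixpoint frename L V V' (f : V -> V') (p : formula L V) : formula L V' :=
  match p with
  | Equal t u => Equal (trename f t) (trename f u)
  | Rel r ts => Rel (fun i => trename f (ts i))
  | Not q => Not (frename f q)
  | And q r => And (frename f q) (frename f r)
  | Exists q => Exists (frename (omap f) q)
  end.

Section DefinableSets.
Variables (L : signature) (M : structure L).

Lemma eval_rename V V' (f : V -> V') (v : V' -> M) (t : term L V) :
  eval v (trename f t) = eval (v \o f) t.
Proof.
elim: t => [//|h ts IH] /=; congr (fun_int _).
by apply: funext => i; rewrite IH.
Qed.

Lemma extend_omap A V V' (f : V -> V') (v : V' -> A) x :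
  extend x v \o omap f = extend x (v \o f).
Proof. by apply: funext => -[]. Qed.

Lemma sat_rename V V' (f : V -> V') (v : V' -> M) (p : formula L V) :
  sat v (frename f p) <-> sat (v \o f) p.
Proof.
elim: p V' f v => {V} [V t u|V r ts|V q IH|V q IHq r IHr|V q IH] V' f v /=.
- by rewrite !eval_rename.
- suff -> : (fun i => eval v (trename f (ts i))) = (fun i => eval (v \o f) (ts i))
    by [].
  by apply: funext => i; rewrite eval_rename.
- by rewrite IH.
- by rewrite IHq IHr.
- have E x : sat (extend x v) (frename (omap f) q) <-> sat (extend x (v \o f)) q.
    by rewrite -extend_omap; apply: IH.
  by split=> -[x Hx]; exists x; apply/E.
Qed.

Definition cat_params k l (a : 'I_k -> M) (b : 'I_l -> M) (i : 'I_(k + l)) : M :=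
  match fintype.split i with inl j => a j | inr j => b j end.

Lemma cat_paramsl k l (a : 'I_k -> M) (b : 'I_l -> M) i :
  cat_params a b (lshift l i) = a i.
Proof. by rewrite /cat_params (unsplitK (inl i)). Qed.

Lemma cat_paramsr k l (a : 'I_k -> M) (b : 'I_l -> M) i :
  cat_params a b (rshift k i) = b i.
Proof. by rewrite /cat_params (unsplitK (inr i)). Qed.

Definition inj_paramsl V k l (v : V + 'I_k) : V + 'I_(k + l) :=
  match v with inl x => inl x | inr i => inr (lshift l i) end.

Definition inj_paramsr V k l (v : V + 'I_l) : V + 'I_(k + l) :=
  match v with inl x => inl x | inr i => inr (rshift k i) end.

Lemma join_paramsl V k l (x : V -> M) (a : 'I_k -> M) (b : 'I_l -> M) :
  join x (cat_params a b) \o @inj_paramsl V k l = join x a.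
Proof. by apply: funext => -[//|i] /=; rewrite cat_paramsl. Qed.

Lemma join_paramsr V k l (x : V -> M) (a : 'I_k -> M) (b : 'I_l -> M) :
  join x (cat_params a b) \o @inj_paramsr V k l = join x b.
Proof. by apply: funext => -[//|i] /=; rewrite cat_paramsr. Qed.

Lemma definable_sat V k (p : formula L (V + 'I_k)) (a : 'I_k -> M) :
  definable [set x | sat (join x a) p].
Proof. by exists k, p, a. Qed.

Lemma definable_ext V (X Y : set (V -> M)) :
  (forall x, X x <-> Y x) -> definable X -> definable Y.
Proof. by move=> XY; suff -> : X = Y by []; apply/predeqP. Qed.

Lemma definableC V (X : set (V -> M)) : definable X -> definable (~` X).
Proof. by case=> k [p [a ->]]; exists k, (Not p), a. Qed.

Lemma definableI V (X Y : set (V -> M)) :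
  definable X -> definable Y -> definable (X `&` Y).
Proof.
case=> k [p [a ->]] [l [q [b ->]]].
exists (k + l)%N, (And (frename (@inj_paramsl V k l) p)
                       (frename (@inj_paramsr V k l) q)), (cat_params a b).
by apply/predeqP => x /=; rewrite !sat_rename join_paramsl join_paramsr.
Qed.

Lemma definableU V (X Y : set (V -> M)) :
  definable X -> definable Y -> definable (X `|` Y).
Proof.
by move=> dX dY; rewrite -[_ `|` _]setCK setCU; do ?apply: definableC;
  apply: definableI; apply: definableC.
Qed.

Lemma definable_comp U V (f : V -> U) (X : set (V -> M)) :
  definable X -> definable [set z : U -> M | X (z \o f)].
Proof.
case=> k [p [a ->]].
pose h (v : V + 'I_k) : U + 'I_k :=
  match v with inl x => inl (f x) | inr i => inr i end.
exists k, (frename h p), a; apply/predeqP => z /=; rewrite sat_rename.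
by have -> : join z a \o h = join (z \o f) a by apply: funext => -[].
Qed.

Lemma definable_param V n (X : set (V + 'I_n -> M)) (b : 'I_n -> M) :
  definable X -> definable [set x | X (join x b)].
Proof.
case=> k [p [a ->]].
pose h (v : V + 'I_n + 'I_k) : V + 'I_(n + k) :=
  match v with
  | inl (inl x) => inl x | inl (inr i) => inr (lshift k i)
  | inr i => inr (rshift n i)
  end.
exists (n + k)%N, (frename h p), (cat_params b a).
apply/predeqP => x /=; rewrite sat_rename.
suff -> : join x (cat_params b a) \o h = join (join x b) a by [].
by apply: funext => -[[//|i]|i] /=; rewrite ?cat_paramsl ?cat_paramsr.
Qed.

Lemma definable_ex V (X : set (option V -> M)) :
  definable X -> definable [set x | exists m, X (extend m x)].
Proof.
case=> k [p [a ->]].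
pose h (v : option V + 'I_k) : option (V + 'I_k) :=
  match v with
  | inl (Some x) => Some (inl x) | inl None => None | inr i => Some (inr i)
  end.
exists k, (Exists (frename h p)), a; apply/predeqP => x /=.
suff E m : extend m (join x a) \o h = join (extend m x) a.
  by split=> -[m Hm]; exists m; move: Hm; rewrite sat_rename E.
by apply: funext => -[[]|].
Qed.

Lemma definable_ex_tuple n V (X : set (V + 'I_n -> M)) :
  definable X -> definable [set x | exists y, X (join x y)].
Proof.
elim: n V X => [|n IH] V X dX.
  pose y0 (i : 'I_0) : M := match i with Ordinal _ h => False_rect M (notF h) end.
  apply: definable_ext (definable_param y0 dX) => x.
  split=> [?|[y]]; first by exists y0.
  by have -> : y = y0 by apply: funext => -[].
pose h (v : V + 'I_n.+1) : option (V + 'I_n) :=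
  match v with
  | inl x => Some (inl x)
  | inr i => omap inr (unlift ord_max i)
  end.
pose snoc (y : 'I_n -> M) (m : M) (i : 'I_n.+1) : M :=
  if unlift ord_max i is Some j then y j else m.
have E (x : V -> M) y m : extend m (join x y) \o h = join x (snoc y m).
  by apply: funext => -[//|i] /=; rewrite /snoc; case: (unlift _ _).
apply: definable_ext (IH V _ (definable_ex (definable_comp h dX))) => x /=.
split=> [[y [m]]|[y Xy]]; first by rewrite E; exists (snoc y m).
exists (fun j => y (lift ord_max j)), (y ord_max); rewrite E.
suff -> : snoc (fun j => y (lift ord_max j)) (y ord_max) = y by [].
by apply: funext => i; rewrite /snoc; case: unliftP => [j ->|->].
Qed.

(** [V] may be empty, so the tautology speaks of a parameter, which exists because structures are
    inhabited. *)
Lemma definableT V : definable [set: V -> M].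
Proof.
have [m] := carrier_inhabited M.
apply: definable_ext (definable_param (fun _ : 'I_1 => m)
  (definable_sat (Equal (Var L (inl (inr ord0))) (Var L (inl (inr ord0))))
                 (fun _ : 'I_1 => m))).
by [].
Qed.

Lemma definable_all (I : finType) V (X : I -> set (V -> M)) :
  (forall i, definable (X i)) -> definable [set x | forall i, X i x].
Proof.
move=> dX.
apply: (@definable_ext V [set x | forall i, i \in enum I -> X i x]).
  by move=> x; split=> h i; [apply: h; rewrite mem_enum | move=> _; apply: h].
elim: (enum I) => [|j s IH]; first by apply: definable_ext (definableT V).
apply: definable_ext (definableI (dX j) IH) => x /=; split.
  by case=> Xj Xs i; rewrite in_cons => /orP[/eqP->|/Xs].
by move=> h; split=> [|i si]; apply: h; rewrite in_cons ?eqxx ?si ?orbT.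
Qed.

End DefinableSets.

(** * Ultrapowers *)

Section Ultrapower.
Variables (L : signature) (M : structure L) (U : set_system nat).
Hypothesis UU : UltraFilter U.

Definition uclass (f : nat -> M) : set (nat -> M) :=
  [set g | U [set n | f n = g n]].

Definition ucarrier := {c : set (nat -> M) | exists f, c = uclass f}.

Definition ucl (f : nat -> M) : ucarrier := exist _ (uclass f) (ex_intro _ f erefl).

Definition urep (x : ucarrier) : nat -> M := projT1 (cid (proj2_sig x)).

Lemma urepK x : ucl (urep x) = x.
Proof.
apply: eq_sig_hprop => [c p q|]; first exact: Prop_irrelevance.
by rewrite /urep; case: (cid _) => f.
Qed.

Lemma ucl_eq f g : ucl f = ucl g <-> U [set n | f n = g n].
Proof.
split=> [[/(congr1 (fun c => c g)) E]|E].
  suff : uclass f g by [].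
  by rewrite E; apply: filterS filterT.
apply: eq_exist; apply/predeqP => h; split; apply: filterS2 E => n /=.
  by move=> ->.
by move=> -> ->.
Qed.

Lemma urep_ucl f : U [set n | urep (ucl f) n = f n].
Proof. by apply/ucl_eq; rewrite urepK. Qed.

Lemma urep_ucl_all (I : finType) (f : I -> nat -> M) :
  U [set n | forall i, urep (ucl (f i)) n = f i n].
Proof. by apply: filter_forall => i; apply: urep_ucl. Qed.

(** The operations are computed on chosen representatives. Arities being finite, [urep_ucl_all]
    shows that other representatives give the same result on a set of [U]. *)
Definition upower : structure L := {|
  carrier := ucarrier;
  carrier_inhabited :=
    let: inhabits m := carrier_inhabited M in inhabits (ucl (fun=> m));
  fun_int f args := ucl (fun n => fun_int (fun i => urep (args i) n));
  rel_int r args := U [set n | rel_int (fun i => urep (args i) n)] |}.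

Lemma ultraC (A : set nat) : ~ U A <-> U (~` A).
Proof.
split; first by case: (in_ultra_setVsetC A UU).
by move=> nA UA; apply: (@filter_not_empty _ U); rewrite -(setICl A); apply: filterI.
Qed.

Lemma eval_ucl V (v : V -> nat -> M) (t : term L V) :
  eval (M := upower) (fun x => ucl (v x)) t =
  ucl (fun n => eval (fun x => v x n) t).
Proof.
elim: t => [//|h ts IH] /=; apply/ucl_eq.
have := urep_ucl_all (fun i n => eval (fun x => v x n) (ts i)).
apply: filterS => n /= E; congr (fun_int _); apply: funext => i.
by rewrite IH.
Qed.

Lemma los V (p : formula L V) (v : V -> nat -> M) :
  sat (M := upower) (fun x => ucl (v x)) p <->
  U [set n | sat (fun x => v x n) p].
Proof.
elim: p v => {V} [V t u|V r ts|V q IH|V q IHq r IHr|V q IH] v.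
- by rewrite /= !eval_ucl ucl_eq.
- have E := urep_ucl_all (fun i n => eval (fun x => v x n) (ts i)).
  rewrite /=; split; apply: filterS2 E => n /= E.
    by congr (rel_int _); apply: funext => i; rewrite eval_ucl.
  by congr (rel_int _); apply: funext => i; rewrite eval_ucl E.
- by rewrite /= IH ultraC.
- rewrite /= IHq IHr; split=> [[]|E]; first exact: filterI.
  by split; apply: filterS E => n [].
- have E (f : nat -> M) : extend (ucl f) (fun x => ucl (v x)) =
      (fun o => ucl (extend f v o)) by apply: funext => -[].
  have E' f n : (fun o => extend f v o n) = extend (f n) (fun x => v x n).
    by apply: funext => -[].
  split=> /=.
    case=> x; rewrite -(urepK x) E IH; apply: filterS => n /=.
    by rewrite E'; exists (urep x n).
  move=> Uq.
  (* A witness is chosen at each coordinate that has one, an arbitrary element at the others. *)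
  have [n|f Hf] := @choice nat M (fun n m =>
      (exists x, sat (extend x (fun y => v y n)) q) ->
      sat (extend m (fun y => v y n)) q).
    have [[m Hm]|Hn] := EM (exists x, sat (extend x (fun y => v y n)) q).
      by exists m.
    by have [m] := carrier_inhabited M; exists m.
  exists (ucl f); rewrite E IH; apply: filterS Uq => n /= /Hf.
  by rewrite E'.
Qed.

Lemma upower_models (T : set (sentence L)) : models M T -> models upower T.
Proof.
move=> MT p /MT Hp.
pose v0 (v : void) : nat -> M := match v with end.
have /los : U [set n | sat (fun x => v0 x n) p].
  suff -> : [set n | sat (fun x => v0 x n) p] = setT by apply: filterT.
  apply/predeqP => n; split=> // _ /=; move: Hp.
  by congr (sat _ p); apply: funext => -[].
by congr (sat _ p); apply: funext => -[].
Qed.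

End Ultrapower.

(** * Codings *)

Section Codings.
Variables (L : signature) (M : structure L).

(** Interpretability asks for formulas for [D] and [E] over the same parameters, hence the
    concatenation of the two tuples. *)
Lemma interpretable_classes n (D : set ('I_n -> M)) (E : ('I_n -> M) -> ('I_n -> M) -> Prop) :
  definable D -> definable [set z : 'I_n + 'I_n -> M | E (z \o inl) (z \o inr)] ->
  equiv_on D E -> interpretable (classes D E).
Proof.
case=> k [p [a Dp]] [l [q [b Eq]]] eqE.
have defD : def_dom (frename (@inj_paramsl 'I_n k l) p) (cat_params a b) = D.
  by apply/predeqP => x; rewrite Dp /def_dom /= sat_rename join_paramsl.
have defE : def_rel (frename (@inj_paramsr ('I_n + 'I_n) k l) q) (cat_params a b) = E.
  apply/funext => x; apply/funext => y; apply/propext.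
  by rewrite /def_rel sat_rename join_paramsr; have /= <- := congr1 (@^~ (join x y)) Eq.
exists (k + l)%N, (frename (@inj_paramsl 'I_n k l) p),
  (frename (@inj_paramsr ('I_n + 'I_n) k l) q), (cat_params a b).
by rewrite /def_quot defD defE.
Qed.

(** Disjoint nonempty sets are the classes of the relation of lying in the same one. Quotients,
    products and images of definable sets are coded in this way. *)
Lemma interpretable_range n B (cd : B -> set ('I_n -> M)) :
  (forall b, exists z, cd b z) ->
  (forall b b' z, cd b z -> cd b' z -> b = b') ->
  definable [set z : 'I_n + 'I_n -> M |
    exists b, cd b (z \o inl) /\ cd b (z \o inr)] ->
  interpretable (range cd).
Proof.
move=> cd0 cd_uniq dE.
pose D := [set z | exists b, cd b z].
pose E z z' := exists b, cd b z /\ cd b z'.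
have dD : definable D.
  pose h (s : 'I_n + 'I_n) := match s with inl i => i | inr i => i end.
  by apply: definable_ext (definable_comp h dE) => z; split=> -[b]; [case|]; exists b.
have eqE : equiv_on D E.
  split=> [z [b bz]|z z' _ _ [b [bz bz']]|x y z _ _ _ [b [bx bY]] [b' [b'y b'z]]].
  - by exists b.
  - by exists b.
  - by exists b; rewrite [b](cd_uniq _ _ _ bY b'y) in bx *.
suff -> : range cd = classes D E by apply: interpretable_classes.
have clE b z : cd b z -> [set y | D y /\ E z y] = cd b.
  move=> bz; apply/predeqP => y; split=> [[_ [b' [b'z b'y]]]|by_].
    by rewrite (cd_uniq _ _ _ bz b'z).
  by split; exists b.
apply/predeqP => c; split=> [[b _ <-]|[z [b bz] <-]].
  by have [z bz] := cd0 b; exists z; [exists b | apply: clE].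
by exists b => //; rewrite (clE b).
Qed.

Section OneCoding.
Variables (A : Type) (c : coding M A).
Let n := arity c.

Lemma code_formulas : exists (D : set ('I_n -> M)) E,
  [/\ definable D, definable [set z : 'I_n + 'I_n -> M | E (z \o inl) (z \o inr)],
      equiv_on D E & range (code c) = classes D E].
Proof.
have [k [d [e [a [eqE ->]]]]] := code_interpretable c.
exists (def_dom d a), (def_rel e a); split=> //; first exact: definable_sat.
apply: definable_ext (definable_sat e a) => z /=; rewrite /def_rel.
by have -> : join (z \o inl) (z \o inr) = z by apply: funext => -[].
Qed.

Lemma code_class D E (x : A) : equiv_on D E -> range (code c) = classes D E ->
  exists2 z, D z & code c x = [set y | D y /\ E z y].
Proof.
move=> _ cE; have : range (code c) (code c x) by exists x.
by rewrite cE => -[z Dz <-]; exists z.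
Qed.

Lemma code_nonempty x : exists z, code c x z.
Proof.
have [D [E [_ _ eqE /(code_class x eqE) [z Dz ->]]]] := code_formulas.
by exists z; split=> //; case: eqE => r _ _; apply: r.
Qed.

Lemma code_uniq x y z : code c x z -> code c y z -> x = y.
Proof.
move=> xz yz; apply: (@code_inj _ _ _ c).
have [D [E [_ _ eqE cE]]] := code_formulas.
have [u Du xE] := code_class x eqE cE; have [v Dv yE] := code_class y eqE cE.
move: xz yz; rewrite xE yE => -[Dz uz] [_ vz]; have [r s t] := eqE.
have uv : E u v by apply: (t _ z) => //; apply: s.
apply/predeqP => w; split=> -[Dw zw]; split=> //.
  by apply: (t _ u) => //; apply: s.
by apply: (t _ v).
Qed.

Lemma code_rel_definable : definable [set z : 'I_n + 'I_n -> M |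
  exists x, code c x (z \o inl) /\ code c x (z \o inr)].
Proof.
have [D [E [dD dE eqE cE]]] := code_formulas.
apply: definable_ext (definableI (definable_comp inl dD)
  (definableI (definable_comp inr dD) dE)) => z /=; case: (eqE) => r s t.
split=> [[D1 [D2 E12]]|[x []]].
  have : classes D E [set y | D y /\ E (z \o inl) y] by exists (z \o inl).
  by rewrite -cE => -[x _ xE]; exists x; rewrite xE; split; split=> //; apply: r.
have [u Du ->] := code_class x eqE cE => -[D1 E1] [D2 E2].
by split=> //; split=> //; apply: t E2 => //; apply: s.
Qed.

Lemma code_dom_definable : definable [set z | exists x, code c x z].
Proof.
pose h (s : 'I_n + 'I_n) := match s with inl i => i | inr i => i end.
apply: definable_ext (definable_comp h code_rel_definable) => z.
by split=> -[b]; [case|]; exists b.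
Qed.

(** * Definable predicates on the elements of a coded type *)

Definition codes (I : Type) (x : I -> A) (z : I * 'I_n -> M) : Prop :=
  forall i, code c (x i) (fun j => z (i, j)).

(** The variables form a finite type, so that [option I] supplies the variable of a quantifier and
    definability can be read off the shape of a predicate on elements. *)
Definition dpred (I : finType) (P : (I -> A) -> Prop) : Prop :=
  definable [set z : I * 'I_n -> M | exists x, P x /\ codes x z].

Lemma codes_uniq I (x y : I -> A) z : codes x z -> codes y z -> x = y.
Proof. by move=> xz yz; apply/funext => i; apply: code_uniq (xz i) (yz i). Qed.

Lemma dpred_ext (I : finType) (P Q : (I -> A) -> Prop) :
  (forall x, P x <-> Q x) -> dpred P -> dpred Q.
Proof. by move=> PQ; apply: definable_ext => z; split=> -[x [/PQ]]; exists x. Qed.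

Lemma codes_dom (I : finType) : definable [set z : I * 'I_n -> M | exists x, codes x z].
Proof.
apply: definable_ext (definable_all (fun i =>
  definable_comp (fun j => (i, j)) code_dom_definable)) => z /=.
by split=> [/choice [x xz]|[x xz] i]; [exists x | exists (x i)].
Qed.

Lemma dpredT (I : finType) : dpred (fun _ : I -> A => True).
Proof. by apply: definable_ext (codes_dom I) => z; split=> -[x]; [|case]; exists x. Qed.

(** The complement has to be restricted to the tuples that code something. *)
Lemma dpred_not (I : finType) (P : (I -> A) -> Prop) : dpred P -> dpred (fun x => ~ P x).
Proof.
move=> dP; apply: definable_ext (definableI (codes_dom I) (definableC dP)) => z /=.
split=> [[[x xz] nP]|[x [nP xz]]]; first by exists x; split=> // Px; apply: nP; exists x.
by split; [exists x | move=> [y [Py /codes_uniq/(_ xz) E]]; apply: nP; rewrite -E].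
Qed.

Lemma dpred_and (I : finType) (P Q : (I -> A) -> Prop) :
  dpred P -> dpred Q -> dpred (fun x => P x /\ Q x).
Proof.
move=> dP dQ; apply: definable_ext (definableI dP dQ) => z /=.
split=> [[[x [Px xz]] [y [Qy /codes_uniq/(_ xz) E]]]|[x [[Px Qx] xz]]].
  by exists x; rewrite -{2}E.
by split; exists x.
Qed.

Lemma dpred_comp (I J : finType) (f : I -> J) (P : (I -> A) -> Prop) :
  dpred P -> dpred (fun x : J -> A => P (x \o f)).
Proof.
move=> dP; apply: definable_ext (definableI (codes_dom J)
  (definable_comp (fun p : I * 'I_n => (f p.1, p.2)) dP)) => z /=.
split=> [[[x xz] [y [Py yz]]]|[x [Px xz]]].
  exists x; suff <- : y = x \o f by [].
  by apply: codes_uniq yz _ => i; apply: xz.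
by split; [exists x | exists (x \o f); split=> // i; apply: xz].
Qed.

Lemma dpred_ex (I : finType) (P : (I -> A) -> A -> Prop) :
  dpred (fun x : option I -> A => P (x \o Some) (x None)) ->
  dpred (fun x => exists s, P x s).
Proof.
move=> dP.
pose h (p : option I * 'I_n) : I * 'I_n + 'I_n :=
  if p.1 is Some i then inl (i, p.2) else inr p.2.
apply: definable_ext (definable_ex_tuple (definable_comp h dP)) => z /=.
split=> [[y [x [Px xz]]]|[x [[s Ps] xz]]].
  exists (x \o Some); split; first by exists (x None).
  by move=> i; apply: xz (Some i).
have [y sy] := code_nonempty s.
exists y, (extend s x); split=> // -[i|]; [exact: xz | exact: sy].
Qed.

Lemma dpred_const (I : finType) (i : I) (a : A) : dpred (fun x : I -> A => x i = a).
Proof.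
have [b ab] := code_nonempty a.
pose h (s : 'I_n + 'I_n) : I * 'I_n + 'I_n :=
  match s with inl k => inl (i, k) | inr k => inr k end.
apply: definable_ext (definableI (codes_dom I)
  (definable_param b (definable_comp h code_rel_definable))) => z /=.
split=> [[[x xz] [s [si sj]]]|[x [xi xz]]].
  by exists x; split=> //; rewrite (code_uniq ab sj); apply: code_uniq (xz i) si.
by split; [exists x | exists a; split=> //; rewrite -xi; apply: xz].
Qed.

Lemma dpred_set (X : set A) : dpred (fun x : unit -> A => X (x tt)) <-> definable_set c X.
Proof.
split=> dX.
  apply: definable_ext (definable_comp (fun p : unit * 'I_n => p.2) dX) => z /=.
  split=> [[x [Xx xz]]|[x [Xx xz]]]; first by exists (x tt); split=> //; apply: (xz tt).
  by exists (fun=> x); split=> // i.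
apply: definable_ext (definable_comp (fun k => (tt, k)) dX) => z /=.
split=> [[x [Xx xz]]|[x [Xx xz]]]; first by exists (fun=> x); split=> // -[].
by exists (x tt); split=> //; apply: xz.
Qed.

End OneCoding.

(** * Codings of quotients and products *)

Definition quot_code A B (c : coding M A) (q : A -> B) (b : B) : set ('I_(arity c) -> M) :=
  [set z | exists x, q x = b /\ code c x z].
Arguments quot_code {A B} c q b _.

Section Quotient.
Variables (A B : Type) (c : coding M A) (q : A -> B).
Hypothesis q_surj : forall b, exists x, q x = b.
Hypothesis dq : dpred c (fun x : bool -> A => q (x true) = q (x false)).

Lemma quot_code_nonempty b : exists z, quot_code c q b z.
Proof.
have [x xb] := q_surj b; have [z xz] := code_nonempty c x.
by exists z, x.
Qed.

Lemma quot_code_uniq b b' z : quot_code c q b z -> quot_code c q b' z -> b = b'.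
Proof. by move=> [x [<- xz]] [y [<- yz]]; rewrite (code_uniq xz yz). Qed.

Lemma quot_code_inj : injective (quot_code c q).
Proof.
move=> b b' E; have [z bz] := quot_code_nonempty b.
have b'z : quot_code c q b' z by rewrite -E.
exact: quot_code_uniq bz b'z.
Qed.

Lemma quot_code_interpretable : interpretable (range (quot_code c q)).
Proof.
apply: (interpretable_range quot_code_nonempty quot_code_uniq).
pose h (p : bool * 'I_(arity c)) : 'I_(arity c) + 'I_(arity c) :=
  if p.1 then inl p.2 else inr p.2.
apply: definable_ext (definable_comp h dq) => z /=; split.
  move=> [x [qx xz]]; exists (q (x true)); split.
    by exists (x true); split=> //; apply: (xz true).
  by exists (x false); split=> //; apply: (xz false).
move=> [b [[x [xb xz]] [y [yb yz]]]].
by exists (fun t => if t then x else y); split; [rewrite /= yb | case].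
Qed.

Definition quot_coding : coding M B := Coding quot_code_inj quot_code_interpretable.

End Quotient.

Section Product.
Variables (A B : Type) (cA : coding M A) (cB : coding M B).

Definition prod_code (x : A * B) : set ('I_(arity cA + arity cB) -> M) :=
  [set z : 'I_(arity cA + arity cB) -> M |
    code cA x.1 (z \o @lshift _ _) /\ code cB x.2 (z \o @rshift _ _)].

Lemma prod_code_nonempty x : exists z, prod_code x z.
Proof.
have [y xy] := code_nonempty cA x.1; have [z xz] := code_nonempty cB x.2.
exists (cat_params y z); split.
  by have -> : cat_params y z \o @lshift _ _ = y by apply: funext => i /=; rewrite cat_paramsl.
by have -> : cat_params y z \o @rshift _ _ = z by apply: funext => i /=; rewrite cat_paramsr.
Qed.

Lemma prod_code_uniq x y z : prod_code x z -> prod_code y z -> x = y.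
Proof.
case: x y => x x' [y y'] [/= xz x'z] [/= yz y'z].
by rewrite (code_uniq xz yz) (code_uniq x'z y'z).
Qed.

Lemma prod_code_inj : injective prod_code.
Proof.
move=> x y E; have [z xz] := prod_code_nonempty x.
have yz : prod_code y z by rewrite -E.
exact: prod_code_uniq xz yz.
Qed.

Lemma prod_code_interpretable : interpretable (range prod_code).
Proof.
apply: (interpretable_range prod_code_nonempty prod_code_uniq).
pose hA (s : 'I_(arity cA) + 'I_(arity cA)) :
    'I_(arity cA + arity cB) + 'I_(arity cA + arity cB) :=
  match s with inl i => inl (lshift _ i) | inr i => inr (lshift _ i) end.
pose hB (s : 'I_(arity cB) + 'I_(arity cB)) :
    'I_(arity cA + arity cB) + 'I_(arity cA + arity cB) :=
  match s with inl i => inl (rshift _ i) | inr i => inr (rshift _ i) end.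
apply: definable_ext (definableI (definable_comp hA (code_rel_definable cA))
  (definable_comp hB (code_rel_definable cB))) => z /=.
split=> [[[x [x1 x2]] [y [y1 y2]]]|[[x y] [[/= x1 y1] [/= x2 y2]]]].
  by exists (x, y).
by split; [exists x | exists y].
Qed.

Definition prod_coding : coding M (A * B) := Coding prod_code_inj prod_code_interpretable.

End Product.

End Codings.

(** * Dimension of definable subsets of a coded type *)

Section Rank.
Variables (L : signature) (T : set (sentence L)) (dim : dim_function L).
Hypothesis dimP : is_dimension T dim.
Variables (M : structure L).
Hypothesis MT : models M T.

(* The empty set gets rank 0. *)
Definition rank A (c : coding M A) (X : set A) : nat :=
  odflt 0%N (dim (code c @` X)).

Lemma definable_set_ext A (c : coding M A) (X Y : set A) :
  (forall x, X x <-> Y x) -> definable_set c X -> definable_set c Y.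
Proof. by move=> XY; suff -> : X = Y by []; apply/predeqP. Qed.

Lemma definable_setU A (c : coding M A) X Y :
  definable_set c X -> definable_set c Y -> definable_set c (X `|` Y).
Proof.
move=> dX dY; apply: definable_ext (definableU dX dY) => z /=; split.
  by case=> -[x [Xx xz]]; exists x; split=> //; [left|right].
by case=> x [[Xx|Yx] xz]; [left|right]; exists x.
Qed.

Lemma interpretable_image A (c : coding M A) X :
  definable_set c X -> interpretable (code c @` X).
Proof.
move=> dX; pose cd (b : {x | X x}) := code c (sval b).
have -> : code c @` X = range cd.
  apply/predeqP => C; split=> [[x Xx <-]|[[x Xx] _ <-]]; last by exists x.
  by exists (exist _ x Xx).
apply: interpretable_range.
- by move=> b; apply: code_nonempty.
- by move=> [b Xb] [b' Xb'] z bz b'z; apply: eq_exist; apply: code_uniq bz b'z.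
apply: definable_ext (definableI (code_rel_definable c)
  (definable_comp inl dX)) => z /=.
split=> [[[x [x1 x2]] [y [Xy y1]]]|[[x Xx] [x1 x2]]].
  by exists (exist _ y Xy); rewrite /cd /= (code_uniq y1 x1).
by split; exists x.
Qed.

Section OneCoding.
Variables (A : Type) (c : coding M A).

Lemma definable_set1 x : definable_set c [set x].
Proof. by apply/dpred_set; apply: dpred_const. Qed.

Lemma finite_code_image X : finite_set (code c @` X) <-> finite_set X.
Proof.
suff /eq_finite_set -> : (code c @` X #= X)%card by [].
by apply: inj_card_eq => x y _ _; apply: (@code_inj _ _ _ c).
Qed.

(** The axioms give dimension [None] to the empty set, but do not say that no other set has it. A
    nonempty [X] absorbs one of its points, which has dimension 0, so the union axiom excludes
    [None]. *)
Lemma dim_image X : definable_set c X -> X !=set0 ->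
  dim (code c @` X) = Some (rank c X).
Proof.
move=> dX [x Xx]; rewrite /rank; case E : (dim _) => [//|].
have [_ /(_ M MT) alg /(_ M MT) dU _] := dimP.
have iX := interpretable_image dX; have ix := interpretable_image (definable_set1 x).
have X1 : code c @` X `|` code c @` [set x] = code c @` X.
  by rewrite -image_setU; congr (_ @` _); apply/setUidPl => _ ->.
have := dU _ _ _ iX ix; rewrite X1 => /(_ iX).
suff -> : dim (code c @` [set x]) = Some 0%N by rewrite E.
apply/(alg _ _ ix).2; split; first exact/finite_code_image/finite_set1.
by exists (code c x), x.
Qed.

Lemma dim_image0 : dim (code c @` set0) = None.
Proof.
have [_ /(_ M MT) alg _ _] := dimP.
have d0 : definable_set c set0.
  apply: definable_ext (definableC (definableT M _)) => z.
  by split=> [/(_ I)|[x []]].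
by apply: (alg _ _ (interpretable_image d0)).1; apply: image_set0.
Qed.

Lemma rank_set0 : rank c set0 = 0%N.
Proof. by rewrite /rank dim_image0. Qed.

Lemma rank_eq0 (X : set A) : definable_set c X -> rank c X = 0%N <-> finite_set X.
Proof.
move=> dX; have [_ /(_ M MT) alg _ _] := dimP.
have [_ Xf] := alg _ _ (interpretable_image dX).
have [->|/set0P X_ne] := eqVneq X set0.
  by rewrite rank_set0; split=> // _; apply: finite_set0.
have DX := dim_image dX X_ne; rewrite -finite_code_image; split=> [X0|fX].
  by have [] : finite_set (code c @` X) /\ code c @` X !=set0 by apply/Xf; rewrite DX X0.
suff : Some (rank c X) = Some 0%N by case.
rewrite -DX; apply/Xf; split=> //.
by case: X_ne => x Xx; exists (code c x), x.
Qed.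

Lemma rankU X Y : definable_set c X -> definable_set c Y ->
  rank c (X `|` Y) = maxn (rank c X) (rank c Y).
Proof.
move=> dX dY; have [_ _ /(_ M MT) dU _] := dimP.
have [->|/set0P X_ne] := eqVneq X set0; first by rewrite set0U rank_set0 max0n.
have [->|/set0P Y_ne] := eqVneq Y set0; first by rewrite setU0 rank_set0 maxn0.
have dXY := definable_setU dX dY.
have := dU _ _ _ (interpretable_image dX) (interpretable_image dY).
rewrite -image_setU => /(_ (interpretable_image dXY)).
rewrite !dim_image //; last by case: X_ne => x; exists x; left.
by rewrite /dim_max /=; case: leqP => _ [->].
Qed.

Lemma rank_sub X Y : definable_set c X -> definable_set c Y ->
  X `<=` Y -> (rank c X <= rank c Y)%N.
Proof. by move=> dX dY /setUidPr <-; rewrite rankU // leq_maxl. Qed.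

End OneCoding.

Section Fibration.
Variables (A B : Type) (cA : coding M A) (cB : coding M B).
Variables (X : set A) (Y : set B) (f : A -> B).
Hypotheses (dX : definable_set cA X) (dY : definable_set cB Y).
Hypothesis fXY : forall x, X x -> Y (f x).
Hypothesis df : definable [set z : 'I_(arity cA) + 'I_(arity cB) -> M |
  exists x, [/\ X x, code cA x (z \o inl) & code cB (f x) (z \o inr)]].

Lemma definable_fibre y : definable_set cA (X `&` f @^-1` [set y]).
Proof.
have [b yb] := code_nonempty cB y.
apply: definable_ext (definable_param b df) => z /=; split.
  move=> [x [Xx xz fxb]]; exists x; split=> //; split=> //.
  exact: code_uniq fxb yb.
by move=> [x [[Xx fx] xz]]; exists x; split=> //; rewrite fx.
Qed.

(** The map [f] transported to codes; a set of tuples that codes nothing is sent to the empty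
    set. *)
Let F (C : set ('I_(arity cA) -> M)) : set ('I_(arity cB) -> M) :=
  [set z | exists2 x, C = code cA x & code cB (f x) z].

Let F_code x : F (code cA x) = code cB (f x).
Proof.
apply/predeqP => z; rewrite /F /=; split=> [|fz]; last by exists x.
by case=> y /(@code_inj _ _ _ cA) ->.
Qed.

Let F_interp : interpretable_fun (code cA @` X) (code cB @` Y) F.
Proof.
split=> [_ [x Xx <-]|]; first by rewrite F_code; exists (f x) => //; apply: fXY.
apply: definable_ext df => z /=; split=> [[x [Xx xz fz]]|[_ [[x Xx <-] xz]]].
  by exists (code cA x); rewrite F_code; split=> //; exists x.
by rewrite F_code => fz; exists x.
Qed.

Let F_fibre y : (code cA @` X) `&` F @^-1` [set code cB y] =
  code cA @` (X `&` f @^-1` [set y]).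
Proof.
apply/predeqP => C; split=> [[[x Xx <-] /=]|[x [Xx /= <-] <-]].
  by rewrite F_code => /(@code_inj _ _ _ cB) fx; exists x.
by split; [exists x | rewrite /= F_code].
Qed.

Lemma rank_fibre_le k :
  (forall y, Y y -> (rank cA (X `&` f @^-1` [set y]) <= k)%N) ->
  (rank cA X <= rank cB Y + k)%N.
Proof.
move=> hk; have [->|/set0P X_ne] := eqVneq X set0; first by rewrite rank_set0.
have Y_ne : Y !=set0 by case: X_ne => x /fXY; exists (f x).
have [_ _ _ /(_ M MT) fib] := dimP.
have [_] := fib _ _ _ _ _ k (interpretable_image dX) (interpretable_image dY) F_interp.
rewrite !dim_image //; apply=> _ [y Yy <-]; rewrite F_fibre.
have [->|/set0P ne] := eqVneq (X `&` f @^-1` [set y]) set0.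
  by rewrite dim_image0.
by rewrite dim_image //; [apply: hk | apply: definable_fibre].
Qed.

(** The nonemptiness conditions are the price of giving rank 0 to the empty set, whose dimension is
    [None]. *)
Lemma rank_fibre_ge k : Y !=set0 ->
  (forall y, Y y -> X `&` f @^-1` [set y] !=set0) ->
  (forall y, Y y -> (k <= rank cA (X `&` f @^-1` [set y]))%N) ->
  (rank cB Y + k <= rank cA X)%N.
Proof.
move=> Y_ne f_ne hk.
have X_ne : X !=set0 by case: Y_ne => y /f_ne [x [Xx _]]; exists x.
have [_ _ _ /(_ M MT) fib] := dimP.
have [+ _] := fib _ _ _ _ _ k (interpretable_image dX) (interpretable_image dY) F_interp.
rewrite !dim_image //; apply=> _ [y Yy <-]; rewrite F_fibre.
by rewrite dim_image //; [apply: hk | apply: definable_fibre | apply: f_ne].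
Qed.

End Fibration.

End Rank.

(** * Chains of definable equivalence relations *)

Lemma infinite_inj_seq B (S : set B) :
  (forall m, exists t : nat -> B, (forall j, (j < m)%N -> S (t j)) /\
     forall j l, (j < l)%N -> (l < m)%N -> t j <> t l) -> ~ finite_set S.
Proof.
move=> St /finite_setP[n]; rewrite card_eq_le => /andP[+ _].
have [t [tS tinj]] := St n.+1 => Sn.
have inj : {in `I_n.+1 &, injective t}.
  move=> j l; rewrite !inE /= => jn ln E.
  by have [jl|lj|//] := ltngtP j l; [have := tinj _ _ jl ln|have := tinj _ _ lj jn]; rewrite E.
have : (`I_n.+1 #<= `I_n)%card.
  apply: card_le_trans Sn; rewrite -(card_le_eql (inj_card_eq inj)).
  by apply: subset_card_le => _ [j jn <-]; apply: tS.
by rewrite card_le_II ltnn.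
Qed.

(** * Ranks of quotients by definable equivalence relations *)

Section ClassCoding.
Variables (L : signature) (M : structure L) (n : nat) (D : set ('I_n -> M)).
Variable E : ('I_n -> M) -> ('I_n -> M) -> Prop.
Hypotheses (dD : definable D) (eqE : equiv_on D E).
Hypothesis dE : definable [set z : 'I_n + 'I_n -> M | E (z \o inl) (z \o inr)].

Definition class_type := {C | classes D E C}.

Lemma class_inj : injective (@sval _ _ : class_type -> set ('I_n -> M)).
Proof. by move=> [C hC] [C' hC'] /= CC'; apply: eq_exist. Qed.

Lemma class_interpretable :
  interpretable (range (@sval _ _ : class_type -> set ('I_n -> M))).
Proof.
suff -> : range (@sval _ _ : class_type -> set ('I_n -> M)) = classes D E.
  exact: interpretable_classes.
apply/predeqP => C; split=> [[[C' hC] _ <-] //|hC].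
by exists (exist _ C hC).
Qed.

Definition class_coding : coding M class_type := Coding class_inj class_interpretable.

Lemma class_setT : definable_set class_coding setT.
Proof.
apply: definable_ext (code_dom_definable class_coding) => z.
by split=> -[x]; [exists x|case; exists x].
Qed.

Definition class_of x (Dx : D x) : class_type :=
  exist _ [set y | D y /\ E x y] (ex_intro2 _ _ x Dx erefl).

Lemma class_of_surj (C : class_type) : exists x : {x | D x}, C = class_of (proj2_sig x).
Proof.
by case: C => C hC; have [x Dx CE] := hC; exists (exist _ x Dx); apply: eq_exist.
Qed.

Lemma class_of_eq x y (Dx : D x) (Dy : D y) : class_of Dx = class_of Dy <-> E x y.
Proof.
case: eqE => r s t; split=> [/(congr1 (fun C => sval C y)) /= CE|xy].
  by have [] : D y /\ E x y by rewrite CE; split=> //; apply: r.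
apply: eq_exist; apply/predeqP => z; split=> -[Dz]; split=> //.
  by apply: (t _ x) => //; apply: s.
exact: (t _ y).
Qed.

End ClassCoding.

Section ClassRank.
Variables (L : signature) (T : set (sentence L)) (dim : dim_function L).
Hypothesis dimP : is_dimension T dim.
Variables (M : structure L).
Hypothesis MT : models M T.
Variables (n : nat) (D : set ('I_n -> M)).
Variable E1 E2 : ('I_n -> M) -> ('I_n -> M) -> Prop.
Hypotheses (dD : definable D) (D_ne : D !=set0).
Hypotheses (eqE1 : equiv_on D E1) (eqE2 : equiv_on D E2).
Hypothesis dE1 : definable [set z : 'I_n + 'I_n -> M | E1 (z \o inl) (z \o inr)].
Hypothesis dE2 : definable [set z : 'I_n + 'I_n -> M | E2 (z \o inl) (z \o inr)].
Hypothesis E21 : forall x y, D x -> D y -> E2 x y -> E1 x y.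

Let c1 := class_coding dD eqE1 dE1.
Let c2 := class_coding dD eqE2 dE2.

Definition coarsen (C : class_type D E2) : class_type D E1 :=
  class_of E1 (proj2_sig (projT1 (cid (class_of_surj C)))).


Lemma coarsen_class x (Dx : D x) : coarsen (class_of E2 Dx) = class_of E1 Dx.
Proof.
rewrite /coarsen; case: cid => -[y Dy] /= /esym/(class_of_eq eqE2) yx.
exact/(class_of_eq eqE1)/E21.
Qed.

Lemma coarsen_definable : definable [set z : 'I_n + 'I_n -> M | exists C : class_type D E2,
  [/\ setT C, sval C (z \o inl) & sval (coarsen C) (z \o inr)]].
Proof.
apply: definable_ext (definableI (definable_comp inl dD)
  (definableI (definable_comp inr dD) dE1)) => z; case: (eqE1) => r1 s1 t1.
split=> [[D1 [D2 E12]]|[C [_]]].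
  exists (class_of E2 D1); rewrite coarsen_class; split=> //; split=> //.
  by case: eqE2 => r _ _; apply: r.
have [[x Dx] ->] := class_of_surj C; rewrite coarsen_class.
move=> [D1 E2x] [D2 E1x]; split=> //; split=> //.
by apply: (t1 _ x) => //; apply: s1 => //; apply: E21.
Qed.

Lemma class_rank_le k :
  (forall x (Dx : D x), (k <= rank dim c2 [set C | coarsen C = class_of E1 Dx])%N) ->
  (rank dim c1 setT + k <= rank dim c2 setT)%N.
Proof.
move=> hk; apply: (rank_fibre_ge dimP MT (f := coarsen)) => //.
- exact: class_setT.
- exact: class_setT.
- exact: coarsen_definable.
- by case: D_ne => x Dx; exists (class_of E1 Dx).
- move=> C _; have [[x Dx] /= ->] := class_of_surj C.
  by exists (class_of E2 Dx); split=> //; apply: coarsen_class.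
- by move=> C _; have [[x Dx] /= ->] := class_of_surj C; rewrite setTI; apply: hk.
Qed.

Lemma class_rank_mono : (rank dim c1 setT <= rank dim c2 setT)%N.
Proof. by have := @class_rank_le 0; rewrite addn0; apply. Qed.

(** By pigeonhole the fibres of [coarsen] are infinite, hence of rank at least 1, and the fibration
    axiom adds this 1 to the rank of the base. *)
Lemma class_rank_lt :
  (forall x, D x -> forall m, exists t : nat -> 'I_n -> M,
     (forall j, (j < m)%N -> D (t j) /\ E1 x (t j)) /\
     forall j l, (j < l)%N -> (l < m)%N -> ~ E2 (t j) (t l)) ->
  (rank dim c1 setT < rank dim c2 setT)%N.
Proof.
move=> split_E1; rewrite -addn1; apply: class_rank_le => x Dx.
have dfib : definable_set c2 [set C | coarsen C = class_of E1 Dx].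
  have := @definable_fibre _ _ _ _ c2 c1 _ _ coarsen_definable (class_of E1 Dx).
  by rewrite setTI.
rewrite lt0n; apply/negP => /eqP /(rank_eq0 dimP MT dfib).
apply: infinite_inj_seq => m.
have [t [tE t_inj]] := split_E1 x Dx m.
(* The class of [x] is a default value, taken only when [t j] is outside [D], which does not happen
   for [j < m]. *)
pose C j := if pselect (D (t j)) is left Dt then class_of E2 Dt else class_of E2 Dx.
have CE j : (j < m)%N -> exists Dt : D (t j), C j = class_of E2 Dt.
  by move=> /tE [Dt _]; rewrite /C; case: pselect => // Dt'; exists Dt'.
exists C; split=> [j /[dup] jm /CE [Dt ->] /=|j l jl lm].
  rewrite coarsen_class; apply/(class_of_eq eqE1); case: eqE1 => _ s _.
  by apply: s => //; case: (tE j jm).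
have [Dl ->] := CE l lm; have [Dj ->] := CE j (ltn_trans jl lm).
by move/(class_of_eq eqE2); apply: t_inj.
Qed.

End ClassRank.

(** * Definable sets in the ultrapower *)

Section Star.
Variables (L : signature) (M : structure L) (U : set_system nat).
Hypothesis UU : UltraFilter U.
Let N := upower M U.

Definition star V (u : nat -> V -> M) : V -> N := fun i => ucl U (u^~ i).

Lemma star_surj V (x : V -> N) : exists u, x = star u.
Proof.
exists (fun m i => urep (x i) m).
by apply/funext => i; rewrite /star urepK.
Qed.

(** [Y] is defined by the formula of [X], with the constant sequences of its parameters; the
    equivalence is the theorem of Łoś. *)
Lemma definable_star V (X : set (V -> M)) : definable X ->
  exists2 Y : set (V -> N), definable Y & forall u, Y (star u) <-> U [set m | X (u m)].
Proof.
case=> k [p [a ->]].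
exists [set x | sat (join x (star (fun=> a))) p]; first exact: definable_sat.
move=> u /=; have := los UU p (fun i m => join (u m) a i).
have -> : (fun i => ucl U ((fun m => join (u m) a i))) = join (star u) (star (fun=> a)).
  by apply/funext => -[].
by move=> ->; split; apply: filterS => m.
Qed.

End Star.

(* Passing to an ultrapower turns ever finer splittings into splittings into  *)
(* infinitely many classes, and each of these raises the dimension.           *)
Lemma no_long_chains L (T : set (sentence L)) (M : structure L) A (c : coding M A)
    (R : A -> A -> A -> Prop) :
  finite_dimensional T -> models M T ->
  dpred c (fun x : option bool -> A => R (x None) (x (Some true)) (x (Some false))) ->
  (forall y, [/\ forall a, R y a a, forall a b, R y a b -> R y b a
     & forall a b e, R y a b -> R y b e -> R y a e]) ->
  ~ forall len m : nat, exists y : nat -> A, forall i, (i < len)%N ->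
      (forall a b, R (y i.+1) a b -> R (y i) a b) /\
      forall a, exists t : nat -> A, (forall j, (j < m)%N -> R (y i) a (t j)) /\
        forall j l, (j < l)%N -> (l < m)%N -> ~ R (y i.+1) (t j) (t l).
Proof.
move=> [dim dimP] MT dR eqR chains.
(* [U] contains all final segments. At coordinate [m] there will be [m] classes, so any fixed number
   of classes is available at almost all coordinates. *)
have [U [UU Uoo]] := ultraFilterLemma eventually_filter.
pose N := upower M U; have NT : models N T by apply: upower_models.
set n := arity c.
have [DN dDN DNE] := definable_star UU (code_dom_definable c).
have [EN dEN ENE] := definable_star UU (code_rel_definable c).
have [RN dRN RNE] := definable_star UU dR.
pose z3 S (y u v : 'I_n -> S) (p : option bool * 'I_n) : S :=
  match p.1 with None => y p.2 | Some true => u p.2 | Some false => v p.2 end.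
pose E0 (u v : 'I_n -> N) := EN (join u v).
pose E (Y u v : 'I_n -> N) := RN (z3 N Y u v).
have DP (u : nat -> 'I_n -> M) :
    DN (star U u) <-> U [set m | exists a, code c a (u m)] by exact: DNE.
have E0P (u v : nat -> 'I_n -> M) : E0 (star U u) (star U v) <->
    U [set m | exists a, code c a (u m) /\ code c a (v m)].
  rewrite /E0; have -> : join (star U u) (star U v) = star U (fun m => join (u m) (v m)).
    by apply/funext => -[].
  exact: ENE.
have EP (Y u v : nat -> 'I_n -> M) : E (star U Y) (star U u) (star U v) <->
    U [set m | exists y a b, [/\ R y a b, code c y (Y m), code c a (u m) & code c b (v m)]].
  rewrite /E; have -> : z3 N (star U Y) (star U u) (star U v) =
      star U (fun m => z3 M (Y m) (u m) (v m)).
    by apply/funext => -[[[]|] i].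
  rewrite RNE; split; apply: filterS => m /=.
    move=> [x [Rx xz]]; exists (x None), (x (Some true)), (x (Some false)).
    split; [exact: Rx|apply: (xz None)|apply: (xz (Some true))|apply: (xz (Some false))].
  move=> [y [a [b [Rab yY au bv]]]].
  exists (fun o => match o with None => y | Some true => a | Some false => b end).
  by split=> // o; case: o => [[]|].
(* Changing a representative outside a set of [U] makes all its coordinates codes, so no exceptional
   coordinates occur in the sequel. *)
have D_star u : DN (star U u) ->
    exists v w, star U u = star U v /\ forall m, code c (w m) (v m).
  move=> /DP Du; have [a0 _] : exists a0 : A, True by have [y _] := chains 0 0; exists (y 0).
  have [z0 a0z] := code_nonempty c a0.
  have [m|w Hw] := @choice nat (A * ('I_n -> M)) (fun m p => code c p.1 p.2 /\
      ((exists a, code c a (u m)) -> p.2 = u m)).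
    have [[a au]|nu] := EM (exists a, code c a (u m)); first by exists (a, u m).
    by exists (a0, z0).
  exists (fun m => (w m).2), (fun m => (w m).1); split; last by move=> m; have [] := Hw m.
  apply/funext => i; apply/ucl_eq; apply: filterS Du => m Dm.
  by have [_ /= ->] := Hw m.
have D_rep x : DN x -> exists v w, x = star U v /\ forall m, code c (w m) (v m).
  by have [u ->] := star_surj x; apply: D_star.
have star_D v w : (forall m, code c (w m) (v m)) -> DN (star U v).
  by move=> vw; apply/DP; apply: filterS filterT => m _; exists (w m).
have E0_rep v w v' w' : (forall m, code c (w m) (v m)) -> (forall m, code c (w' m) (v' m)) ->
    E0 (star U v) (star U v') <-> U [set m | w m = w' m].
  move=> vw vw'; rewrite E0P; split; apply: filterS => m /=.
    by move=> [a [/(code_uniq (vw m)) -> /(code_uniq (vw' m)) ->]].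
  by move=> E01; exists (w m); split; [|rewrite E01].
have E_rep Y y v w v' w' : (forall m, code c (y m) (Y m)) ->
    (forall m, code c (w m) (v m)) -> (forall m, code c (w' m) (v' m)) ->
    E (star U Y) (star U v) (star U v') <-> U [set m | R (y m) (w m) (w' m)].
  move=> Yy vw vw'; rewrite EP; split; apply: filterS => m /=.
    by move=> [a [b [e [+ /(code_uniq (Yy m)) -> /(code_uniq (vw m)) ->]]]]
              /(code_uniq (vw' m)) ->.
  by move=> Rm; exists (y m), (w m), (w' m).
have eqE0 : equiv_on DN E0.
  split=> [x /D_rep[v [w [-> vw]]]|x x' /D_rep[v [w [-> vw]]] /D_rep[v' [w' [-> vw']]]|].
  - by rewrite (E0_rep _ _ _ _ vw vw); apply: filterS filterT.
  - rewrite (E0_rep _ _ _ _ vw vw') (E0_rep _ _ _ _ vw' vw).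
    by apply: filterS => m /= ->.
  move=> x x' x'' /D_rep[v [w [-> vw]]] /D_rep[v' [w' [-> vw']]] /D_rep[v'' [w'' [-> vw'']]].
  rewrite (E0_rep _ _ _ _ vw vw') (E0_rep _ _ _ _ vw' vw'') (E0_rep _ _ _ _ vw vw'').
  by apply: filterS2 => m /= -> ->.
have eqE Y : DN Y -> equiv_on DN (E Y).
  move=> /D_rep[{}Y [y [-> Yy]]].
  split=> [x /D_rep[v [w [-> vw]]]|x x' /D_rep[v [w [-> vw]]] /D_rep[v' [w' [-> vw']]]|].
  - rewrite (E_rep _ _ _ _ _ _ Yy vw vw); apply: filterS filterT => m _ /=.
    by case: (eqR (y m)).
  - rewrite (E_rep _ _ _ _ _ _ Yy vw vw') (E_rep _ _ _ _ _ _ Yy vw' vw).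
    by apply: filterS => m /=; have [_ + _] := eqR (y m); apply.
  move=> x x' x'' /D_rep[v [w [-> vw]]] /D_rep[v' [w' [-> vw']]] /D_rep[v'' [w'' [-> vw'']]].
  rewrite (E_rep _ _ _ _ _ _ Yy vw vw') (E_rep _ _ _ _ _ _ Yy vw' vw'').
  rewrite (E_rep _ _ _ _ _ _ Yy vw vw'').
  by apply: filterS2 => m /=; have [_ _] := eqR (y m); apply.
have dE0 : definable [set z : 'I_n + 'I_n -> N | E0 (z \o inl) (z \o inr)].
  apply: definable_ext dEN => z; rewrite /E0 /=.
  by have -> : join (z \o inl) (z \o inr) = z by apply/funext => -[].
have dE Y : definable [set z : 'I_n + 'I_n -> N | E Y (z \o inl) (z \o inr)].
  pose h (p : option bool * 'I_n) : 'I_n + 'I_n + 'I_n :=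
    match p.1 with
    | None => inr p.2 | Some true => inl (inl p.2) | Some false => inl (inr p.2)
    end.
  apply: definable_ext (definable_param Y (definable_comp h dRN)) => z.
  rewrite /E /=; suff -> : join z Y \o h = z3 N Y (z \o inl) (z \o inr) by [].
  by apply/funext => -[[[]|] i].
(* Equality of coded elements refines every relation of the chain, so [d0] bounds the ranks of all
   the quotients. A chain with [d0 + 1] steps, each raising the rank, is therefore impossible. *)
pose d0 := rank dim (class_coding dDN eqE0 dE0) setT.
have [y Hy] := choice (chains d0.+1).
have [Y HY] := choice (fun p : nat * nat => code_nonempty c (y p.1 p.2)).
pose YN i := star U (fun m => Y (m, i)).
have YD i : DN (YN i) by apply: star_D => m; apply: (HY (m, i)).
have EY_rep i v w v' w' : (forall m, code c (w m) (v m)) ->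
    (forall m, code c (w' m) (v' m)) ->
    E (YN i) (star U v) (star U v') <-> U [set m | R (y m i) (w m) (w' m)].
  by apply: E_rep => m; apply: (HY (m, i)).
have DN_ne : DN !=set0 by exists (YN 0).
pose ci i := class_coding dDN (eqE _ (YD i)) (dE (YN i)).
have ci_lt i : (i < d0.+1)%N -> (rank dim (ci i) setT < rank dim (ci i.+1) setT)%N.
  move=> id0; apply: (class_rank_lt dimP NT dDN DN_ne) => [|x /D_rep[v [w [-> vw]]] m0].
    move=> x x' /D_rep[v [w [-> vw]]] /D_rep[v' [w' [-> vw']]].
    rewrite (EY_rep _ _ _ _ _ vw vw') (EY_rep _ _ _ _ _ vw vw').
    by apply: filterS => m /=; have [+ _] := Hy m i id0; apply.
  have [t Ht] := choice (fun m => (Hy m i id0).2 (w m)).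
  have [u Hu] := choice (fun p : nat * nat => code_nonempty c (t p.1 p.2)).
  exists (fun j => star U (fun m => u (m, j))); split=> [j _|j l jl _].
    have uj m : code c (t m j) (u (m, j)) by apply: (Hu (m, j)).
    split; first exact: star_D uj.
    rewrite (EY_rep _ _ _ _ _ vw uj).
    apply: filterS (Uoo _ (ex_intro2 _ _ j.+1 I (fun _ h => h))) => m /= jm.
    by have [+ _] := Ht m; apply.
  have uj m : code c (t m j) (u (m, j)) by apply: (Hu (m, j)).
  have ul m : code c (t m l) (u (m, l)) by apply: (Hu (m, l)).
  rewrite (EY_rep _ _ _ _ _ uj ul) ultraC.
  apply: filterS (Uoo _ (ex_intro2 _ _ l.+1 I (fun _ h => h))) => m /= lm.
  by have [_ +] := Ht m; apply.
have ci_ge i : (i <= d0.+1)%N -> (i <= rank dim (ci i) setT)%N.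
  elim: i => // i IH id0; apply: leq_ltn_trans (ci_lt i id0).
  by apply: IH; apply: ltnW.
have : (rank dim (ci d0.+1) setT <= d0)%N.
  apply: (class_rank_mono dimP NT dDN DN_ne).
  move=> x x' /D_rep[v [w [-> vw]]] /D_rep[v' [w' [-> vw']]].
  rewrite (E0_rep _ _ _ _ vw vw') (EY_rep _ _ _ _ _ vw vw').
  by apply: filterS => m /= ->; case: (eqR (y m d0.+1)).
by rewrite leqNgt ci_ge.
Qed.

(** * Definable predicates and terms in several sorts *)

Section Sorts.
Variables (L : signature) (M : structure L) (S : Type) (cS : coding M S).

(* Variables range over S only; the elements of A are reached as the images of *)
(* elements of S under sort_proj.                                              *)
Record vsort (A : Type) := VSort {
  sort_coding : coding M A;
  sort_proj : S -> A;
  sort_index : 'I_(arity sort_coding) -> 'I_(arity cS);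
  sort_surj : forall a, exists s, sort_proj s = a;
  sort_code : forall s z, code cS s z ->
    code sort_coding (sort_proj s) (z \o sort_index) }.

Definition dterm A (p : vsort A) (I : finType) (t : (I -> S) -> A) : Prop :=
  dpred cS (fun x : option I -> S => sort_proj p (x None) = t (x \o Some)).

Section OneSort.
Variables (A : Type) (p : vsort A).

Lemma sort_codes (I : Type) (x : I -> S) z i : codes (c := cS) x z ->
  code (sort_coding p) (sort_proj p (x i)) (fun k => z (i, sort_index k)).
Proof. by move=> xz; apply: sort_code (xz i). Qed.

Lemma dpred_in_proj (X : set A) (I : finType) (i : I) :
  definable_set (sort_coding p) X -> dpred cS (fun x : I -> S => X (sort_proj p (x i))).
Proof.
move=> dX; apply: definable_ext (definableI (codes_dom cS I)
  (definable_comp (fun k => (i, sort_index k)) dX)) => z /=.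
split=> [[[x xz] [a [Xa az]]]|[x [Xx xz]]].
  by exists x; rewrite -(code_uniq az (sort_codes i xz)).
by split; [exists x | exists (sort_proj p (x i)); split=> //; apply: sort_codes xz].
Qed.

Lemma definable_set_proj (X : set A) :
  dpred cS (fun x : unit -> S => X (sort_proj p (x tt))) -> definable_set (sort_coding p) X.
Proof.
move=> dX.
pose n := arity (sort_coding p).
pose h1 (k : unit * 'I_(arity cS)) : 'I_n + 'I_(arity cS) := inr k.2.
pose h2 (k : 'I_n + 'I_n) : 'I_n + 'I_(arity cS) :=
  match k with inl k => inl k | inr k => inr (sort_index k) end.
apply: definable_ext (definable_ex_tuple (definableI (definable_comp h1 dX)
  (definable_comp h2 (code_rel_definable (sort_coding p))))) => z /=; split.
  move=> [y [[x [Xx xy]] [a [az ay]]]]; exists a; split=> //.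
  by rewrite (code_uniq ay (sort_codes tt xy)).
move=> [a [Xa az]]; have [s sa] := sort_surj p a; have [y sy] := code_nonempty cS s.
exists y; split; first by exists (fun=> s); rewrite sa; split.
by exists a; split=> //; rewrite -sa; apply: sort_code sy.
Qed.

Lemma dterm_comp (I J : finType) (f : I -> J) (t : (I -> S) -> A) :
  dterm p t -> dterm p (fun x : J -> S => t (x \o f)).
Proof. by move=> dt; apply: (dpred_comp (omap f) dt). Qed.

Lemma dpred_exs (I : finType) (P : (I -> S) -> A -> Prop) :
  dpred cS (fun x : option I -> S => P (x \o Some) (sort_proj p (x None))) ->
  dpred cS (fun x => exists a, P x a).
Proof.
move=> dP; apply: dpred_ext (dpred_ex (P := fun x s => P x (sort_proj p s)) dP) => x.
split=> [[s Ps]|[a Pa]]; first by exists (sort_proj p s).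
by have [s sa] := sort_surj p a; exists s; rewrite sa.
Qed.

Lemma dpred_alls (I : finType) (P : (I -> S) -> A -> Prop) :
  dpred cS (fun x : option I -> S => P (x \o Some) (sort_proj p (x None))) ->
  dpred cS (fun x => forall a, P x a).
Proof.
move=> dP; have := dpred_not (dpred_exs (P := fun x a => ~ P x a) (dpred_not dP)).
apply: dpred_ext => x; split=> [nex a|all [a] //].
by have [//|nP] := EM (P x a); case: nex; exists a.
Qed.

Lemma dpred_subst (I : finType) (P : (I -> S) -> A -> Prop) (t : (I -> S) -> A) :
  dpred cS (fun x : option I -> S => P (x \o Some) (sort_proj p (x None))) ->
  dterm p t -> dpred cS (fun x => P x (t x)).
Proof.
move=> dP dt; apply: dpred_ext (dpred_exs (P := fun x a => a = t x /\ P x a) _) => [x|].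
  by split=> [[a [->]]|Pt] //; exists (t x).
exact: dpred_and.
Qed.

Lemma dterm_var (I : finType) (i : I) : dterm p (fun x : I -> S => sort_proj p (x i)).
Proof.
pose h (k : 'I_(arity (sort_coding p)) + 'I_(arity (sort_coding p))) :
    option I * 'I_(arity cS) :=
  match k with
  | inl k => (None, sort_index k) | inr k => (Some i, sort_index k)
  end.
apply: definable_ext (definableI (codes_dom cS (option I))
  (definable_comp h (code_rel_definable (sort_coding p)))) => z /=; split.
  move=> [[x xz] [a [a1 a2]]]; exists x; split=> //.
  rewrite -(code_uniq a1 (sort_codes None xz)).
  exact: code_uniq a2 (sort_codes (Some i) xz).
move=> [x [xE xz]]; split; first by exists x.
exists (sort_proj p (x None)); split; first exact: (sort_codes None xz).
by rewrite xE; apply: (sort_codes (Some i) xz).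
Qed.

Lemma dterm_const (I : finType) (a : A) : dterm p (fun _ : I -> S => a).
Proof.
apply: (@dpred_in_proj [set a]).
by apply/dpred_set; apply: dpred_const.
Qed.

Lemma dpred_eq (I : finType) (t u : (I -> S) -> A) :
  dterm p t -> dterm p u -> dpred cS (fun x => t x = u x).
Proof.
move=> dt du; apply: (dpred_subst (P := fun x a => a = u x)) dt.
exact: du.
Qed.

Lemma dpred_in (X : set A) (I : finType) (t : (I -> S) -> A) :
  definable_set (sort_coding p) X -> dterm p t -> dpred cS (fun x => X (t x)).
Proof. by move=> dX; apply: (dpred_subst (P := fun _ a => X a)); apply: dpred_in_proj. Qed.

End OneSort.

Lemma dterm_op A1 A2 A3 (p1 : vsort A1) (p2 : vsort A2) (p3 : vsort A3) f :
  definable_op (sort_coding p1) (sort_coding p2) (sort_coding p3) f ->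
  forall (I : finType) (t : (I -> S) -> A1) (u : (I -> S) -> A2),
  dterm p1 t -> dterm p2 u -> dterm p3 (fun x => f (t x) (u x)).
Proof.
move=> df I t u dt du.
suff graph (J : finType) (i j k : J) : dpred cS (fun x : J -> S =>
    sort_proj p3 (x k) = f (sort_proj p1 (x i)) (sort_proj p2 (x j))).
  apply: (dpred_subst (P := fun x a => sort_proj p3 (x None) = f a (u (x \o Some))))
    (dterm_comp Some dt).
  apply: (dpred_subst (P := fun x b => sort_proj p3 (x (Some None)) =
    f (sort_proj p1 (x None)) b)) (dterm_comp Some (dterm_comp Some du)).
  exact: graph.
pose h (v : 'I_(arity (sort_coding p1)) + 'I_(arity (sort_coding p2))
    + 'I_(arity (sort_coding p3))) : J * 'I_(arity cS) :=
  match v with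
  | inl (inl v) => (i, sort_index v) | inl (inr v) => (j, sort_index v)
  | inr v => (k, sort_index v)
  end.
apply: definable_ext (definableI (codes_dom cS J) (definable_comp h df)) => z /=; split.
  move=> [[x xz] [a [b [a1 b1 c1]]]]; exists x; split=> //.
  rewrite -(code_uniq c1 (sort_codes p3 k xz)).
  by rewrite (code_uniq a1 (sort_codes p1 i xz)) (code_uniq b1 (sort_codes p2 j xz)).
move=> [x [xE xz]]; split; first by exists x.
exists (sort_proj p1 (x i)), (sort_proj p2 (x j)).
split; [exact: sort_codes xz | exact: sort_codes xz |].
by rewrite -xE; apply: (sort_codes p3 k xz).
Qed.

Lemma definable_op_proj A1 A2 A3 (p1 : vsort A1) (p2 : vsort A2) (p3 : vsort A3) f :
  dpred cS (fun x : option bool -> S => sort_proj p3 (x None) =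
    f (sort_proj p1 (x (Some true))) (sort_proj p2 (x (Some false)))) ->
  definable_op (sort_coding p1) (sort_coding p2) (sort_coding p3) f.
Proof.
move=> dg; set n1 := arity (sort_coding p1); set n2 := arity (sort_coding p2).
set n3 := arity (sort_coding p3); set k := arity cS.
pose V := ('I_n1 + 'I_n2 + 'I_n3 + 'I_k + 'I_k + 'I_k)%type.
pose h (v : option bool * 'I_k) : V :=
  match v.1 with
  | Some true => inl (inl (inr v.2)) | Some false => inl (inr v.2) | None => inr v.2
  end.
pose h1 (v : 'I_n1 + 'I_n1) : V :=
  match v with inl i => inl (inl (inl (inl (inl i)))) | inr i => inl (inl (inr (sort_index i))) end.
pose h2 (v : 'I_n2 + 'I_n2) : V :=
  match v with inl i => inl (inl (inl (inl (inr i)))) | inr i => inl (inr (sort_index i)) end.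
pose h3 (v : 'I_n3 + 'I_n3) : V :=
  match v with inl i => inl (inl (inl (inr i))) | inr i => inr (sort_index i) end.
have := definable_ex_tuple (definable_ex_tuple (definable_ex_tuple
  (definableI (definable_comp h dg)
  (definableI (definable_comp h1 (code_rel_definable (sort_coding p1)))
  (definableI (definable_comp h2 (code_rel_definable (sort_coding p2)))
              (definable_comp h3 (code_rel_definable (sort_coding p3)))))))).
apply: definable_ext => z /=; split.
  move=> [y1 [y2 [y3 [[x [xE xy]] [[a [az ay]] [[b [bz bY]] [c [cz cY]]]]]]]].
  exists a, b; split=> //.
  rewrite (code_uniq ay (sort_codes p1 (Some true) xy)).
  rewrite (code_uniq bY (sort_codes p2 (Some false) xy)) -xE.
  by rewrite -(code_uniq cY (sort_codes p3 None xy)).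
move=> [a [b [az bz cz]]].
have [s sa] := sort_surj p1 a; have [t tb] := sort_surj p2 b.
have [u uc] := sort_surj p3 (f a b).
have [y1 sy] := code_nonempty cS s; have [y2 ty] := code_nonempty cS t.
have [y3 uy] := code_nonempty cS u; exists y1, y2, y3; split.
  exists (fun o => match o with Some true => s | Some false => t | None => u end).
  by split; [rewrite sa tb | case=> [[]|]].
split; first by exists a; split=> //; rewrite -sa; apply: sort_code sy.
split; first by exists b; split=> //; rewrite -tb; apply: sort_code ty.
by exists (f a b); split=> //; rewrite -uc; apply: sort_code uy.
Qed.

Lemma dpred_or (I : finType) (P Q : (I -> S) -> Prop) :
  dpred cS P -> dpred cS Q -> dpred cS (fun x => P x \/ Q x).
Proof.
move=> dP dQ; apply: dpred_ext (dpred_not (dpred_and (dpred_not dP) (dpred_not dQ))) => x.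
split=> [h|[h|h] []] //.
by have [|nP] := EM (P x); [left|right; have [|nQ] := EM (Q x) => //; case: h].
Qed.

Lemma dpred_seq (K : eqType) (I : finType) (P : K -> (I -> S) -> Prop) (s : seq K) :
  (forall k, dpred cS (P k)) -> dpred cS (fun x => exists2 k, k \in s & P k x).
Proof.
move=> dP; elim: s => [|k s IH].
  by apply: dpred_ext (dpred_not (dpredT cS I)) => x; split=> [[]|[]].
apply: dpred_ext (dpred_or (dP k) IH) => x; split.
  case=> [Px|[j js Pj]]; first by exists k; rewrite ?mem_head.
  by exists j; rewrite // in_cons js orbT.
by move=> [j]; rewrite in_cons => /orP[/eqP->|js] Pj; [left | right; exists j].
Qed.

Definition sort_id : vsort S.
Proof.
by apply: (@VSort S cS id id) => [a|s z]; [exists a|].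
Defined.

End Sorts.

Section ProductSorts.
Variables (L : signature) (M : structure L) (A B : Type).
Variables (cA : coding M A) (cB : coding M B) (a0 : A) (b0 : B).

Lemma sort_fst : vsort (prod_coding cA cB) A.
Proof.
apply: (@VSort _ _ _ (prod_coding cA cB) A cA fst (lshift _)) => [a|s z []] //.
by exists (a, b0).
Defined.

Lemma sort_snd : vsort (prod_coding cA cB) B.
Proof.
apply: (@VSort _ _ _ (prod_coding cA cB) B cB snd (@rshift _ _)) => [b|s z []] //.
by exists (a0, b).
Defined.

End ProductSorts.

(** * Subgroups of finite index *)

Section FiniteIndex.
Variable A : zmodType.

Definition subgroup (B : set A) : Prop := B 0 /\ forall x y, B x -> B y -> B (x - y).

Lemma subgroupN B x : subgroup B -> B x -> B (- x).
Proof. by move=> [B0 BB] Bx; rewrite -sub0r; apply: BB. Qed.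

Lemma subgroupD B x y : subgroup B -> B x -> B y -> B (x + y).
Proof.
by move=> sB Bx By; rewrite -[y]opprK; case: (sB) => _; apply=> //; apply: subgroupN.
Qed.

Lemma subgroup_zmodClosed B : subgroup B -> exists U : zmodClosed A, [set` U] = B.
Proof.
move=> [B0 BB].
pose p (x : A) := `[< B x >].
have zB : zmod_closed p.
  split=> [|x y]; first exact/asboolP.
  by move=> /asboolP Bx /asboolP By; apply/asboolP/BB.
pose U : zmodClosed A := HB.pack p (GRing.isZmodClosed.Build A p zB).
by exists U; apply/predeqP => x; split=> [/asboolP|Bx] //; apply/asboolP.
Qed.

End FiniteIndex.

Lemma finite_range_index (A : Type) (B : eqType) (h : A -> B) (X : set A) (Y : set B) :
  finite_set Y -> (forall x, X x -> Y (h x)) ->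
  exists n (f : A -> 'I_n), forall x y, X x -> X y -> f x = f y -> h x = h y.
Proof.
(* The indices involved are below the size of [s]; the successor keeps the target inhabited when [s]
   is empty. *)
move=> /finite_seqP[s ->] hXY; exists (size s).+1, (fun x => inord (index (h x) s)).
move=> x y /hXY hx /hXY hy /(congr1 val) /=.
rewrite !inordK ?ltnS ?index_size // => E.
by rewrite -(nth_index (h x) hx) E nth_index.
Qed.

(* X is covered by finitely many cosets of B. *)
Definition covered (A : zmodType) (B X : set A) : Prop :=
  exists n (f : A -> 'I_n), forall x y, X x -> X y -> f x = f y -> B (x - y).

(** Agrees with [finite_index] on subgroups, by [finite_indexP]. A colouring with [n] colours is
    easier to intersect and to pull back than a set of cosets. *)
Definition fin_index (A : zmodType) (B : set A) : Prop := covered B setT.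

Lemma coveredS (A : zmodType) (B B' X X' : set A) :
  B `<=` B' -> X' `<=` X -> covered B X -> covered B' X'.
Proof.
by move=> BB XX [n [f fB]]; exists n, f => x y /XX Xx /XX Xy /(fB _ _ Xx Xy) /BB.
Qed.

Lemma covered_preim (A A' : zmodType) (h : A' -> A) (B X : set A) :
  {morph h : x y / x - y} -> covered B X -> covered (h @^-1` B) (h @^-1` X).
Proof.
move=> hB [n [f fB]]; exists n, (f \o h) => x y Xx Xy /= E.
by rewrite /preimage /= hB; apply: fB.
Qed.

Lemma covered_range (A : zmodType) (B' : eqType) (h : A -> B') (B X : set A) (Y : set B') :
  finite_set Y -> (forall x, X x -> Y (h x)) ->
  (forall x y, X x -> X y -> h x = h y -> B (x - y)) -> covered B X.
Proof.
move=> fY hXY hB; have [n [f fP]] := finite_range_index fY hXY.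
by exists n, f => x y Xx Xy /(fP _ _ Xx Xy); apply: hB.
Qed.

Lemma covered_finite (A : zmodType) (B X : set A) : B 0 -> finite_set X -> covered B X.
Proof.
move=> B0 fX; apply: (@covered_range A A id) fX _ _ => // x y _ _ /= ->.
by rewrite subrr.
Qed.

Lemma coveredI (A : zmodType) (B C X : set A) :
  covered B X -> covered C X -> covered (B `&` C) X.
Proof.
move=> [n [f fB]] [m [h hC]].
exists #|{: 'I_n * 'I_m}|, (fun x => enum_rank (f x, h x)) => x y Xx Xy.
by move=> /enum_rank_inj [Ef Eh]; split; [apply: fB | apply: hC].
Qed.

Lemma covered_seq (A : zmodType) (K : eqType) (C : K -> set A) (s : seq K) :
  (forall k, k \in s -> fin_index (C k)) ->
  fin_index [set x | forall k, k \in s -> C k x].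
Proof.
elim: s => [|k s IH] Cs; first by exists 1%N, (fun=> ord0).
have := coveredI (Cs k (mem_head _ _)) (IH (fun j js => Cs j (@mem_behead _ (k :: s) j js))).
by apply: coveredS => // x [Ck Cx] j; rewrite in_cons => /orP[/eqP->|/Cx].
Qed.

Lemma covered_reps (A : zmodType) (B X : set A) : covered B X ->
  exists s : seq A, (forall c, c \in s -> X c) /\
    forall x, X x -> exists2 c, c \in s & B (x - c).
Proof.
move=> [n [f fB]].
have [[x0 Xx0]|nX] := EM (exists x, X x); last first.
  by exists [::]; split=> // x Xx; case: nX; exists x.
have [i|c Hc] := @choice 'I_n A (fun i c => X c /\ ((exists x, X x /\ f x = i) -> f c = i)).
  have [[x [Xx fx]]|nx] := EM (exists x, X x /\ f x = i); first by exists x.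
  by exists x0.
exists [seq c i | i <- enum 'I_n]; split=> [_ /mapP[i _ ->]|x Xx].
  by case: (Hc i).
exists (c (f x)); first by apply: map_f; rewrite mem_enum.
have [Xc fc] := Hc (f x); apply: fB => //; rewrite fc //; by exists x.
Qed.

Lemma covered_finite_set (A : zmodType) (B X : set A) :
  finite_set B -> covered B X -> finite_set X.
Proof.
move=> fB /covered_reps[s [_ sX]].
apply: (@sub_finite_set _ _ (\bigcup_(c in [set` s]) [set c + b | b in B])).
  by move=> x /sX[c cs Bx]; exists c => //; exists (x - c) => //; rewrite addrC subrK.
by apply: bigcup_finite => // c _; apply: finite_image.
Qed.

Lemma finite_indexP (A : zmodType) (B : set A) :
  subgroup B -> finite_index B <-> fin_index B.
Proof.
move=> sB; have [B0 BB] := sB; split.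
  move=> /(fun fX => finite_range_index (X := setT) fX (fun x _ => ex_intro2 _ _ x I erefl)).
  move=> [n [f fP]]; exists n, f => x y _ _ /(fP x y I I) /predeqP/(_ x)[+ _].
  case; first by exists 0; rewrite ?addr0.
  by move=> b Bb <-; rewrite addrC addKr.
move=> [n [f fB]].
suff : finite_set (range (fun x : A => [set x + b | b in B])) by [].
have [s [_ sX]] := covered_reps (ex_intro _ n (ex_intro _ f fB)).
apply: (@sub_finite_set _ _ [set [set c + b | b in B] | c in [set` s]]).
  move=> _ [x _ <-]; have [c cs Bxc] := sX x I; exists c => //.
  apply/predeqP => z; split=> -[b Bb <-].
    exists (b - (x - c)); first exact: BB.
    by rewrite opprB addrCA [x + _]addrC subrK addrC.
  exists (b + (x - c)); first exact: subgroupD.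
  by rewrite addrCA [c + _]addrC subrK addrC.
exact: finite_image.
Qed.

Lemma quot_eqE (A : zmodType) (U : zmodClosed A) (x y : A) :
  \pi_{quot U} x = \pi_{quot U} y <-> [set` U] (x - y).
Proof.
have E : (\pi_{quot U} x == \pi_{quot U} y) = (x - y \in U).
  by rewrite piE Quotient.equivE.
by rewrite /= -E; split=> /eqP.
Qed.

Lemma quot_surj (A : zmodType) (U : zmodClosed A) (b : {quot U}) :
  exists a, \pi_{quot U} a = b.
Proof. by exists (repr b); apply: reprK. Qed.

(** * Ranks of subgroups *)

Section RankSorts.
Variables (L : signature) (T : set (sentence L)) (dim : dim_function L).
Hypothesis dimP : is_dimension T dim.
Variables (M : structure L).
Hypothesis MT : models M T.
Variables (S : Type) (cS : coding M S).

Lemma sort_graph A B (p : vsort cS A) (q : vsort cS B) (X : set A) (f : A -> B) :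
  definable_set (sort_coding p) X ->
  dterm q (fun x : unit -> S => f (sort_proj p (x tt))) ->
  definable [set z : 'I_(arity (sort_coding p)) + 'I_(arity (sort_coding q)) -> M |
    exists a, [/\ X a, code (sort_coding p) a (z \o inl) &
                  code (sort_coding q) (f a) (z \o inr)]].
Proof.
move=> dX df; set n := arity (sort_coding p); set m := arity (sort_coding q).
set k := arity cS.
pose h (v : option unit * 'I_k) : 'I_n + 'I_m + 'I_k + 'I_k :=
  if v.1 is Some _ then inl (inr v.2) else inr v.2.
pose hp (v : 'I_n + 'I_n) : 'I_n + 'I_m + 'I_k + 'I_k :=
  match v with inl i => inl (inl (inl i)) | inr i => inl (inr (sort_index i)) end.
pose hq (v : 'I_m + 'I_m) : 'I_n + 'I_m + 'I_k + 'I_k :=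
  match v with inl i => inl (inl (inr i)) | inr i => inr (sort_index i) end.
have := definable_ex_tuple (definable_ex_tuple (definableI (definable_comp h df)
  (definableI (definable_comp hp (code_rel_definable (sort_coding p)))
              (definable_comp hq (code_rel_definable (sort_coding q)))))).
move=> /(definableI (definable_comp inl dX)); apply: definable_ext => z /=; split.
  move=> [[a [Xa az]] [y1 [y2 [[x [xE xy]] [[a' [a'z a'y]] [b [bz bY]]]]]]].
  exists a; split=> //; rewrite (code_uniq az a'z).
  rewrite (code_uniq a'y (sort_codes p (Some tt) xy)) -xE.
  by rewrite -(code_uniq bY (sort_codes q None xy)).
move=> [a [Xa az fz]]; split; first by exists a.
have [s sa] := sort_surj p a; have [t tf] := sort_surj q (f a).
have [y1 sy] := code_nonempty cS s; have [y2 ty] := code_nonempty cS t.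
exists y1, y2; split.
  exists (fun o => if o is Some _ then s else t); split; first by rewrite /= sa.
  by move=> [[]|].
split; first by exists a; split=> //; rewrite -sa; apply: sort_code sy.
by exists (f a); split=> //; rewrite -tf; apply: sort_code ty.
Qed.

Section Fibres.
Variables (A B : Type) (p : vsort cS A) (q : vsort cS B).
Variables (X : set A) (Y : set B) (f : A -> B).
Hypotheses (dX : definable_set (sort_coding p) X) (dY : definable_set (sort_coding q) Y).
Hypothesis fXY : forall x, X x -> Y (f x).
Hypothesis df : dterm q (fun x : unit -> S => f (sort_proj p (x tt))).

Lemma rank_le_fibres k :
  (forall y, Y y -> (rank dim (sort_coding p) (X `&` f @^-1` [set y]) <= k)%N) ->
  (rank dim (sort_coding p) X <= rank dim (sort_coding q) Y + k)%N.
Proof. by apply: (rank_fibre_le dimP MT dX dY fXY (sort_graph dX df)). Qed.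

Lemma rank_ge_fibres k : Y !=set0 ->
  (forall y, Y y -> X `&` f @^-1` [set y] !=set0) ->
  (forall y, Y y -> (k <= rank dim (sort_coding p) (X `&` f @^-1` [set y]))%N) ->
  (rank dim (sort_coding q) Y + k <= rank dim (sort_coding p) X)%N.
Proof. by apply: (rank_fibre_ge dimP MT dX dY fXY (sort_graph dX df)). Qed.

Lemma definable_set_fibre y :
  definable_set (sort_coding p) (X `&` f @^-1` [set y]).
Proof. exact: definable_fibre (sort_graph dX df) y. Qed.

Lemma rank_le_finite_fibres :
  (forall y, Y y -> finite_set (X `&` f @^-1` [set y])) ->
  (rank dim (sort_coding p) X <= rank dim (sort_coding q) Y)%N.
Proof.
move=> ff; rewrite -[leqRHS]addn0; apply: rank_le_fibres => y Yy.
by rewrite leqn0; apply/eqP/(rank_eq0 dimP MT (definable_set_fibre y))/ff.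
Qed.

End Fibres.

Lemma sort_quot A B (p : vsort cS A) (q : A -> B) :
  (forall b, exists a, q a = b) ->
  dpred (sort_coding p) (fun x : bool -> A => q (x true) = q (x false)) -> vsort cS B.
Proof.
move=> q_surj dq.
apply: (@VSort L M S cS B (quot_coding q_surj dq) (q \o sort_proj p) (@sort_index _ _ _ _ _ p)).
  move=> b; have [a ab] := q_surj b; have [s sa] := sort_surj p a.
  by exists s; rewrite /= sa.
by move=> s z sz; exists (sort_proj p s); split=> //; apply: sort_code.
Defined.

Lemma dterm_sub (A : zmodType) (p : vsort cS A) (I : finType) (t u : (I -> S) -> A) :
  definable_op (sort_coding p) (sort_coding p) (sort_coding p) +%R ->
  dterm p t -> dterm p u -> dterm p (fun x => t x - u x).
Proof.
move=> dadd dt du.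
have dE := dpred_eq (dterm_op dadd (dterm_var p None) (dterm_comp Some du))
  (dterm_comp Some dt).
apply: dpred_ext dE => x /=; split=> [<-|->]; first by rewrite addrK.
by rewrite subrK.
Qed.

End RankSorts.

Section RankSubgroups.
Variables (L : signature) (T : set (sentence L)) (dim : dim_function L).
Hypothesis dimP : is_dimension T dim.
Variables (M : structure L).
Hypothesis MT : models M T.
Variables (A : zmodType) (c : coding M A).
Hypothesis dadd : definable_op c c c +%R.
Variables (G H : set A).
Hypotheses (sG : subgroup G) (sH : subgroup H) (HG : H `<=` G).
Hypotheses (dG : definable_set c G) (dH : definable_set c H).

Let p := sort_id c.

Lemma rank_coset a : rank dim c [set x | H (x - a)] = rank dim c H.
Proof.
have dp : definable_op (sort_coding p) (sort_coding p) (sort_coding p) +%R by [].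
have da : definable_set c [set x | H (x - a)].
  apply: (@definable_set_proj _ _ _ _ _ p).
  apply: (dpred_in (p := p) dH); apply: dterm_sub => //; [exact: dterm_var|exact: dterm_const].
have inj (b : A) (X : set A) y : finite_set (X `&` (fun x => x - b) @^-1` [set y]).
  apply: sub_finite_set (finite_set1 (y + b)) => x [_ /= <-].
  by rewrite subrK.
apply/eqP; rewrite eqn_leq; apply/andP; split.
  apply: (rank_le_finite_fibres dimP MT (p := p) (q := p) (f := fun x => x - a)) => //.
  by apply: dterm_sub => //; [apply: dterm_var|apply: dterm_const].
apply: (rank_le_finite_fibres dimP MT (p := p) (q := p) (f := fun x => x - - a)) => //.
  by move=> x /=; rewrite opprK addrK.
by apply: dterm_sub => //; [apply: dterm_var|apply: dterm_const].
Qed.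

(** The fibres of the projection of [G] to [G/H] are cosets of [H], all of the rank of [H]. Hence
    rank [G] = rank [G/H] + rank [H], and [G/H] has rank 0 exactly when it is finite. *)
Lemma rank_covered : covered H G <-> (rank dim c G <= rank dim c H)%N.
Proof.
have dp : definable_op (sort_coding p) (sort_coding p) (sort_coding p) +%R by [].
have [U UH] := subgroup_zmodClosed sH.
have piE x y : \pi_{quot U} x = \pi_{quot U} y <-> H (x - y).
  by rewrite -UH; apply: quot_eqE.
have dpi : dpred c (fun x : bool -> A => \pi_{quot U} (x true) = \pi_{quot U} (x false)).
  apply: dpred_ext (dpred_in (p := p) dH (dterm_sub dp (dterm_var p true) (dterm_var p false))) => x.
  by rewrite piE.
pose q := sort_quot (p := p) (@quot_surj _ U) dpi.
pose Y := [set \pi_{quot U} x | x in G].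
have YE x : Y (\pi_{quot U} x) <-> G x.
  split=> [[y Gy /piE/HG]|Gx]; last by exists x.
  by move=> Gyx; rewrite -(subKr y x); case: sG => _; apply.
have dY : definable_set (sort_coding q) Y.
  apply: (@definable_set_proj _ _ _ _ _ q).
  by apply: dpred_ext (dpred_in (p := p) dG (dterm_var p tt)) => x; rewrite YE.
have dq : dterm q (fun x : unit -> A => \pi_{quot U} (x tt)) := dterm_var q tt.
have fib x : G x -> G `&` (fun x => \pi_{quot U} x) @^-1` [set \pi_{quot U} x] =
    [set y | H (y - x)].
  move=> Gx; apply/predeqP => y; split=> [[_ /piE] //|Hyx]; split; last exact/piE.
  by rewrite -(subrK x y); apply: subgroupD => //; apply: HG.
have fibr y : Y y -> rank dim (sort_coding p)
    (G `&` (fun x => \pi_{quot U} x) @^-1` [set y]) = rank dim c H.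
  by case=> x Gx <-; rewrite fib // rank_coset.
have rle : (rank dim c G <= rank dim (sort_coding q) Y + rank dim c H)%N.
  apply: (rank_le_fibres dimP MT (p := p) (q := q) dG dY _ dq) => [x /YE //|y Yy].
  by rewrite fibr.
have rge : (rank dim (sort_coding q) Y + rank dim c H <= rank dim c G)%N.
  apply: (rank_ge_fibres dimP MT (p := p) (q := q) dG dY _ dq) => [x /YE //||y|y Yy].
  - by exists (\pi_{quot U} 0); apply/YE; case: sG.
  - by case=> x Gx <-; exists x.
  - by rewrite fibr.
have -> : (rank dim c G <= rank dim c H)%N <-> finite_set Y.
  rewrite -(rank_eq0 dimP MT dY); split=> [GH|Y0]; last by rewrite Y0 in rle.
  by apply/eqP; rewrite -leqn0 -(leq_add2r (rank dim c H)) add0n; apply: leq_trans GH.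
split=> [[n [f fH]]|fY]; last first.
  apply: (@covered_range A _ \pi_{quot U} H G) fY _ _ => [x Gx|x y _ _].
    by exists x.
  by move/piE.
have [s [sG' sP]] := covered_reps (ex_intro _ n (ex_intro _ f fH)).
apply: (@sub_finite_set _ _ [set \pi_{quot U} x | x in [set` s]]).
  by move=> _ [x /sP[a sa Ha] <-]; exists a => //; apply/piE; rewrite -opprB; apply: subgroupN.
exact: finite_image.
Qed.

End RankSubgroups.

(** * Fields from operations on an additive group *)

Section FieldOfOps.
Variables (A : zmodType) (mul : A -> A -> A) (e : A).
Hypotheses (mulA : associative mul) (mulC : commutative mul) (mul1 : left_id e mul).
Hypotheses (mulDl : left_distributive mul +%R) (e0 : e != 0).
Variable inv : A -> A.
Hypotheses (mulV : forall a, a != 0 -> mul (inv a) a = e) (inv00 : inv 0 = 0).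

(** A copy of [A] that carries the multiplication, while [A] keeps its own structure. *)
Definition ops_field : Type := A.

HB.instance Definition _ := GRing.Zmodule.on ops_field.
HB.instance Definition _ :=
  GRing.Zmodule_isComNzRing.Build ops_field mulA mulC mul1 mulDl e0.
HB.instance Definition _ := GRing.ComNzRing_isField.Build ops_field mulV inv00.

Definition to_ops_field (a : A) : ops_field := a.

HB.instance Definition _ := GRing.isZmodMorphism.Build A ops_field to_ops_field
  (fun _ _ => erefl).

Lemma ops_fieldP : exists (K : fieldType) (f : {additive A -> K}),
  bijective f /\ forall a b, f (mul a b) = f a * f b.
Proof.
exists ops_field, to_ops_field; split=> //.
by exists (fun x : ops_field => x : A).
Qed.

End FieldOfOps.

(** * Minimal modules over abelian Lie rings *)

Section MinimalModule.
Variables (L : signature) (T : set (sentence L)).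
Hypothesis hT : finite_dimensional T.
Variable M : structure L.
Hypothesis MT : models M T.
Variables (g W : zmodType) (act : g -> W -> W).
Hypothesis act_bi : biadditive act.
Hypothesis actC : forall x y w, act x (act y w) = act y (act x w).
Variables (cg : coding M g) (cW : coding M W).
Hypothesis def_addg : definable_op cg cg cg +%R.
Hypothesis def_addW : definable_op cW cW cW +%R.
Hypothesis def_act : definable_op cg cW cW act.
Hypothesis minimal_W : minimal_module cW act.
Hypothesis nontrivial : ~ almost_trivial act.

(** All variables range over pairs, so formulas that mix [g] and [W] have variables of one type;
    each variable is used through one of its projections. *)
Let cS : coding M (g * W) := prod_coding cg cW.
Let sg : vsort cS g := sort_fst cg cW 0.
Let sw : vsort cS W := sort_snd cg cW 0.

Lemma actDr x : {morph act x : v w / v + w}. Proof. exact: act_bi.1. Qed.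
Lemma actDl w : {morph act^~ w : x y / x + y}. Proof. exact: act_bi.2. Qed.

Lemma act0r x : act x 0 = 0.
Proof. by apply: (addrI (act x 0)); rewrite -actDr !addr0. Qed.

Lemma act0l w : act 0 w = 0.
Proof. by apply: (addrI (act 0 w)); rewrite -(actDl w 0 0) !addr0. Qed.

Lemma actNr x w : act x (- w) = - act x w.
Proof. by apply: (addrI (act x w)); rewrite -actDr !subrr act0r. Qed.

Lemma actNl x w : act (- x) w = - act x w.
Proof. by apply: (addrI (act x w)); rewrite -(actDl w x) !subrr act0l. Qed.

Lemma actBr x : {morph act x : v w / v - w}.
Proof. by move=> v w; rewrite actDr actNr. Qed.

Lemma actBl w : {morph act^~ w : x y / x - y}.
Proof. by move=> x y; rewrite /= (actDl w x) actNl. Qed.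

(** * Kernels, annihilators and torsion *)

Definition stable (Z : set W) : Prop := forall x w, Z w -> Z (act x w).

Definition ann (w : W) : set g := [set x | act x w = 0].
Definition ker (x : g) : set W := [set w | act x w = 0].
(** The almost zero elements will form [g0], and the torsion elements [W0]. *)
Definition almost_zero (x : g) : Prop := fin_index (ker x).
Definition torsion (w : W) : Prop := exists2 x, ~ almost_zero x & act x w = 0.

Lemma definable_setW (Z : set W) :
  dpred cS (fun x : unit -> g * W => Z (x tt).2) -> definable_set cW Z.
Proof. exact: (@definable_set_proj _ _ _ _ _ sw). Qed.

Lemma definable_setg (Z : set g) :
  dpred cS (fun x : unit -> g * W => Z (x tt).1) -> definable_set cg Z.
Proof. exact: (@definable_set_proj _ _ _ _ _ sg). Qed.

Lemma dterm_act (I : finType) (t : (I -> g * W) -> g) (u : (I -> g * W) -> W) :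
  dterm sg t -> dterm sw u -> dterm sw (fun x => act (t x) (u x)).
Proof. exact: (dterm_op (p1 := sg) (p2 := sw) (p3 := sw) def_act). Qed.

Lemma dterm_addW (I : finType) (t u : (I -> g * W) -> W) :
  dterm sw t -> dterm sw u -> dterm sw (fun x => t x + u x).
Proof. exact: (dterm_op (p1 := sw) (p2 := sw) (p3 := sw) def_addW). Qed.

Lemma dterm_subW (I : finType) (t u : (I -> g * W) -> W) :
  dterm sw t -> dterm sw u -> dterm sw (fun x => t x - u x).
Proof. exact: (dterm_sub (p := sw) def_addW). Qed.

Lemma minimal (Z : set W) : subgroup Z -> stable Z -> definable_set cW Z ->
  finite_set Z \/ fin_index Z.
Proof.
move=> sZ tZ dZ; have [U UZ] := subgroup_zmodClosed sZ.
have [x w|||] := @minimal_W U.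
- by move=> wU; have : [set` U] w by []; rewrite UZ => /(tZ x); rewrite -UZ.
- by rewrite UZ.
- by rewrite UZ; left.
- by rewrite UZ => /(finite_indexP sZ); right.
Qed.

Lemma subgroup_ker x : subgroup (ker x).
Proof. by split=> [|v w]; rewrite /ker /= ?act0r // actBr => -> ->; rewrite subr0. Qed.

Lemma stable_ker x : stable (ker x).
Proof. by move=> y w; rewrite /ker /= actC => ->; apply: act0r. Qed.

Lemma definable_ker x : definable_set cW (ker x).
Proof.
apply: definable_setW; apply: (dpred_eq (p := sw)); last exact: dterm_const.
by apply: dterm_act; [apply: dterm_const | apply: (dterm_var sw)].
Qed.

Lemma not_almost_zero_ker x : ~ almost_zero x -> finite_set (ker x).
Proof. by have [] := minimal (subgroup_ker x) (@stable_ker x) (definable_ker x). Qed.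

Lemma subgroup_almost_zero : subgroup almost_zero.
Proof.
split=> [|x y hx hy].
  by exists 1%N, (fun=> ord0) => v w _ _ _; apply: act0l.
apply: coveredS (coveredI hx hy) => // w [xw yw].
by rewrite /ker /= actBl xw yw subr0.
Qed.

Lemma almost_zero_index : ~ fin_index almost_zero.
Proof.
move=> /(finite_indexP subgroup_almost_zero) h; apply: nontrivial.
rewrite /almost_trivial; suff -> : almost_centralizer act = almost_zero by [].
by apply/predeqP => x; apply: finite_indexP; apply: subgroup_ker.
Qed.

(** This is how the nontriviality of the action enters almost everywhere below. *)
Lemma ex_not_almost_zero (C : set g) : fin_index C -> exists2 x, C x & ~ almost_zero x.
Proof.
move=> fC; have [//|nC] := EM (exists2 x, C x & ~ almost_zero x).
case: almost_zero_index; apply: coveredS fC => // x Cx.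
by have [//|nx] := EM (almost_zero x); case: nC; exists x.
Qed.

Lemma infinite_W : ~ finite_set [set: W].
Proof.
move=> fW; apply: almost_zero_index; exists 1%N, (fun=> ord0) => x y _ _ _.
by apply: covered_finite => //; apply: act0r.
Qed.

(** If [x] kills [w], commutativity puts all of [g w] into the finite kernel of [x]. Having an
    annihilator of finite index is preserved by finite intersections: hence torsion elements form a
    subgroup, and finitely many of them are killed by one [x]. *)
Lemma torsion_ann w : torsion w <-> fin_index (ann w).
Proof.
split=> [[x nx xw]|/ex_not_almost_zero[x xw nx]]; last by exists x.
apply: (@covered_range _ _ (act^~ w) (ann w) setT) (not_almost_zero_ker nx) _ _.
  by move=> y _; rewrite /ker /= actC xw act0r.
by move=> y z _ _ E; rewrite /ann /= actBl E subrr.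
Qed.

Lemma finite_orbit_torsion w (F : set W) : finite_set F ->
  (forall x, F (act x w)) -> torsion w.
Proof.
move=> fF hF; apply/torsion_ann.
apply: (@covered_range _ _ (act^~ w) (ann w) setT) fF _ _ => // y z _ _ E.
by rewrite /ann /= actBl E subrr.
Qed.

Lemma subgroup_torsion : subgroup torsion.
Proof.
split=> [|v w /torsion_ann fv /torsion_ann fw].
  by apply: (finite_orbit_torsion (finite_set1 0)) => x; rewrite /= act0r.
apply/torsion_ann; apply: coveredS (coveredI fv fw) => // x [xv xw].
by rewrite /ann /= actBr xv xw subr0.
Qed.

Lemma stable_torsion : stable torsion.
Proof. by move=> x w [y ny yw]; exists y => //; rewrite actC yw act0r. Qed.

Lemma finite_stable_torsion (Z : set W) : finite_set Z -> stable Z -> Z `<=` torsion.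
Proof. by move=> fZ tZ w Zw; apply: (finite_orbit_torsion fZ) => x; apply: tZ. Qed.

Lemma ex_not_almost_zero_seq (s : seq W) : (forall w, w \in s -> torsion w) ->
  exists2 x, ~ almost_zero x & forall w, w \in s -> act x w = 0.
Proof.
move=> sT; have [|x xs nx] := @ex_not_almost_zero [set x | forall w, w \in s -> ann w x].
  by apply: covered_seq => w /sT/torsion_ann.
by exists x.
Qed.

(** * Chains of equivalence relations parametrized by [g] *)

Lemma no_long_chainsW (R : g -> W -> W -> Prop) :
  dpred cS (fun x : option bool -> g * W =>
    R (x None).1 (x (Some true)).2 (x (Some false)).2) ->
  (forall y, [/\ forall a, R y a a, forall a b, R y a b -> R y b a
     & forall a b e, R y a b -> R y b e -> R y a e]) ->
  ~ forall len m : nat, exists y : nat -> g, forall i, (i < len)%N ->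
      (forall a b, R (y i.+1) a b -> R (y i) a b) /\
      forall a, exists t : nat -> W, (forall j, (j < m)%N -> R (y i) a (t j)) /\
        forall j l, (j < l)%N -> (l < m)%N -> ~ R (y i.+1) (t j) (t l).
Proof.
move=> dR eqR chains.
apply: (@no_long_chains _ _ _ _ _ (fun y a b : g * W => R y.1 a.2 b.2) hT MT dR).
  move=> y; have [r s t] := eqR y.1; split=> [a|a b|a b e]; [exact: r|exact: s|exact: t].
move=> len m; have [y Hy] := chains len m; exists (fun i => (y i, 0)) => i il /=.
have [sub spl] := Hy i il; split=> [a b|a]; first exact: sub.
by have [t Ht] := spl a.2; exists (fun j => (0, t j)).
Qed.

Definition splits (R : g -> W -> W -> Prop) (m : nat) (x x' : g) : Prop :=
  (forall a b, R x' a b -> R x a b) /\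
  forall a, exists t : nat -> W, (forall j, (j < m)%N -> R x a (t j)) /\
    forall j l, (j < l)%N -> (l < m)%N -> ~ R x' (t j) (t l).

Section NoChains.
Variable R : g -> W -> W -> Prop.
Hypothesis dR : dpred cS (fun x : option bool -> g * W =>
    R (x None).1 (x (Some true)).2 (x (Some false)).2).
Hypothesis eqR : forall y, [/\ forall a, R y a a, forall a b, R y a b -> R y b a
     & forall a b e, R y a b -> R y b e -> R y a e].
Variable P : g -> Prop.
Hypothesis exP : exists x, P x.

Lemma iter_step (Q : g -> g -> Prop) :
  (forall x, P x -> exists2 x', P x' & Q x x') ->
  exists y : nat -> g, forall i, Q (y i) (y i.+1).
Proof.
move=> step; have [x0 Px0] := exP.
have [[x Px]|F HF] := @choice {x | P x} {x | P x} (fun p p' => Q (sval p) (sval p')).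
  by have [x' Px' Qx] := step x Px; exists (exist _ x' Px').
by exists (fun i => sval (iter i F (exist _ x0 Px0))) => i; apply: HF.
Qed.

Lemma no_refinements : ~ forall m x, P x -> exists2 x', P x' & splits R m x x'.
Proof.
move=> step; apply: (no_long_chainsW dR eqR) => len m.
have [y Hy] := iter_step (step m).
by exists y => i _; apply: Hy.
Qed.

(** The iteration now starts from the finest relation; read backwards from index [len], it is a
    chain of refinements. *)
Lemma no_coarsenings : ~ forall m x, P x -> exists2 x', P x' & splits R m x' x.
Proof.
move=> step; apply: (no_long_chainsW dR eqR) => len m.
have [y Hy] := iter_step (step m).
by exists (fun i => y (len - i)%N) => i il; have := Hy (len - i.+1)%N; rewrite (subnSK il).
Qed.

End NoChains.

Lemma ex_not_almost_zeroT : exists x, ~ almost_zero x.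
Proof.
have [|x _ nx] := @ex_not_almost_zero setT; last by exists x.
by exists 1%N, (fun=> ord0).
Qed.

Lemma infinite_seq (B : choiceType) (Y : set B) (b0 : B) m : ~ finite_set Y ->
  exists t : nat -> B, (forall j, (j < m)%N -> Y (t j)) /\
    forall j l, (j < l)%N -> (l < m)%N -> t j <> t l.
Proof.
move=> /(infinite_set_fset m)[X XY mX].
exists (nth b0 (finmap.enum_fset X)); split=> [j jm|j l jl lm E].
  by apply: XY; rewrite /=; apply: mem_nth; apply: leq_trans jm mX.
have := nth_uniq b0 (leq_trans (ltn_trans jl lm) mX) (leq_trans lm mX) (finmap.fset_uniq X).
by rewrite E eqxx => /esym/eqP jl'; rewrite jl' ltnn in jl.
Qed.

(* Any finite set of torsion elements lies in the kernel of some x that is not *)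
(* almost zero, so an infinite torsion part would give long chains of finite   *)
(* kernels with large indices.                                                 *)
Lemma finite_torsion : finite_set torsion.
Proof.
have [//|infT] := EM (finite_set torsion).
case: (@no_coarsenings (fun y a b => act y a = act y b) _ _ _ ex_not_almost_zeroT).
- apply: (dpred_eq (p := sw)); apply: dterm_act;
    by [apply: (dterm_var sg) | apply: (dterm_var sw)].
- by move=> y; split=> [//|a b -> //|a b e -> ->].
move=> m x nx.
have inf_xT : ~ finite_set (act x @` torsion).
  move=> fxT; apply: infT; apply: (@covered_finite_set _ (ker x)).
    exact: not_almost_zero_ker.
  apply: (@covered_range _ _ (act x) (ker x) torsion) fxT _ _ => [w Tw|v w _ _ E].
    by exists w.
  by rewrite /ker /= actBr E subrr.
have [u [uT u_inj]] := @infinite_seq W _ 0 m inf_xT.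
have [j|t Ht] := @choice nat W (fun j w => (j < m)%N -> torsion w /\ act x w = u j).
  have [jm|mj] := ltnP j m; last by exists 0.
  by have [w Tw xw] := uT j jm; exists w.
have /finite_seqP[s sE] := not_almost_zero_ker nx.
(* [x'] kills the kernel of [x], which is torsion, so its fibres are unions of fibres of [x]. It
   also kills the [t j], so the elements [a + t j] lie in one fibre of [x'], but in distinct fibres
   of [x]. *)
have [|x' nx' Hx'] := @ex_not_almost_zero_seq (s ++ [seq t j | j <- iota 0 m]).
  move=> w; rewrite mem_cat => /orP[ws|/mapP[j]].
    have : [set` s] w by [].
    by rewrite -sE => xw; exists x.
  by rewrite mem_iota => jm ->; have [] := Ht j jm.
exists x' => //; split=> [a b E|a].
  apply/eqP; rewrite -subr_eq0 -actBr; apply/eqP/Hx'; rewrite mem_cat.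
  by have : ker x (a - b); [rewrite /ker /= actBr E subrr|rewrite sE /= => ->].
exists (fun j => a + t j); split=> [j jm|j l jl lm].
  rewrite actDr (Hx' (t j)) ?addr0 // mem_cat; apply/orP; right.
  by apply: map_f; rewrite mem_iota.
rewrite !actDr => /addrI; have [_ ->] := Ht j (ltn_trans jl lm).
by have [_ ->] := Ht l lm; apply: u_inj.
Qed.

(** * Definability of [g0] and injectivity modulo torsion *)

Lemma definable_finite (Z : set W) : finite_set Z -> definable_set cW Z.
Proof.
move=> /finite_seqP[s ->]; elim: s => [|w s IH].
  apply: definable_ext (definableC (definableT M _)) => z.
  by split=> [/(_ I)|[x []]].
apply: definable_set_ext (definable_setU (definable_set1 cW w) IH) => v /=.
by rewrite in_cons; split=> [[->|->]|/orP[/eqP|]]; rewrite ?eqxx ?orbT //; [left|right].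
Qed.

Lemma definable_torsion : definable_set cW torsion.
Proof. exact: definable_finite finite_torsion. Qed.

(** This makes [almost_zero] definable. If the kernel of [x] has finite index, the image of [x] is
    finite and stable under [g], hence torsion; conversely, a map into the finite torsion has a
    kernel of finite index. *)
Lemma almost_zeroP x : almost_zero x <-> forall w, torsion (act x w).
Proof.
split=> [zx|hx].
  have fxW : finite_set (range (act x)).
    have [s [_ sP]] := covered_reps zx.
    apply: (@sub_finite_set _ _ [set act x c | c in [set` s]]); last exact: finite_image.
    move=> _ [w _ <-]; have [c cs /eqP] := sP w I; rewrite /ker /= actBr subr_eq0.
    by move=> /eqP E; exists c.
  by move=> w; apply: (finite_orbit_torsion fxW) => y; exists (act y w).
apply: (@covered_range _ _ (act x) (ker x) setT) finite_torsion _ _ => // v w _ _ E.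
by rewrite /ker /= actBr E subrr.
Qed.

Lemma definable_almost_zero : definable_set cg almost_zero.
Proof.
apply: definable_setg; apply: dpred_ext (fun x => iff_sym (almost_zeroP _)) _.
apply: (dpred_alls (p := sw)); apply: (dpred_in (p := sw) definable_torsion).
by apply: dterm_act; [apply: (dterm_var sg) | apply: (dterm_var sw)].
Qed.

(** The preimage of the torsion under [x] is finite, since the torsion and the kernel of [x] are,
    and it is stable because [g] acts by commuting maps. *)
Lemma torsion_act x w : ~ almost_zero x -> torsion (act x w) -> torsion w.
Proof.
move=> nx Txw; pose F := [set v | torsion (act x v)].
apply: (@finite_orbit_torsion w F); last first.
  by move=> y; rewrite /F /= actC; apply: stable_torsion.
apply: (@covered_finite_set _ (ker x)); first exact: not_almost_zero_ker.
apply: (@covered_range _ _ (act x) (ker x) F) finite_torsion _ _ => // u v _ _ E.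
by rewrite /ker /= actBr E subrr.
Qed.

Lemma ex_not_torsion : exists w, ~ torsion w.
Proof.
have [//|nT] := EM (exists w, ~ torsion w).
case: infinite_W; apply: sub_finite_set finite_torsion => w _.
by have [//|nw] := EM (torsion w); case: nT; exists w.
Qed.

(** * Surjectivity modulo torsion *)

Lemma iter_actD x n : {morph iter n (act x) : v w / v + w}.
Proof. by move=> v w; elim: n => //= n ->; rewrite actDr. Qed.

Lemma iter_actN x n w : iter n (act x) (- w) = - iter n (act x) w.
Proof. by elim: n => //= n ->; rewrite actNr. Qed.

Lemma iter_actC x n y w : iter n (act x) (act y w) = act y (iter n (act x) w).
Proof. by elim: n => //= n ->; rewrite actC. Qed.

Lemma torsion_iter x n w : ~ almost_zero x -> torsion (iter n (act x) w) -> torsion w.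
Proof. by move=> nx; elim: n => //= n IH /(torsion_act nx). Qed.

(** The image [x W] is an infinite definable submodule, so minimality gives it finite index in [W];
    and [x] carries finitely many cosets of [Z] to finitely many cosets of [x Z]. *)
Lemma image_index x (Z : set W) : ~ almost_zero x -> fin_index Z ->
  fin_index [set act x z | z in Z].
Proof.
move=> nx [n [f fZ]].
have sxW : subgroup (range (act x)).
  split=> [|_ _ [v _ <-] [w _ <-]]; first by exists 0; rewrite ?act0r.
  by exists (v - w); rewrite ?actBr.
have txW : stable (range (act x)) by move=> y _ [w _ <-]; exists (act y w); rewrite // actC.
have dxW : definable_set cW (range (act x)).
  apply: definable_setW.
  apply: dpred_ext (dpred_exs (p := sw) (P := fun (y : unit -> g * W) w => act x w = (y tt).2) _) => [y|].
    by split=> [[w <-]|[w _ <-]]; exists w.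
  apply: (dpred_eq (p := sw)); last exact: (dterm_var sw).
  by apply: dterm_act; [apply: dterm_const | apply: (dterm_var sw)].
have [fxW|[m [h hxW]]] := minimal sxW txW dxW.
  case: infinite_W; apply: (@covered_finite_set _ (ker x)); first exact: not_almost_zero_ker.
  apply: (@covered_range _ _ (act x) (ker x) setT) fxW _ _ => [w _|v w _ _ E]; first by exists w.
  by rewrite /ker /= actBr E subrr.
have [s [_ sP]] := covered_reps (ex_intro _ m (ex_intro _ h hxW)).
have [v|c Hc] := @choice W (W * W) (fun v p => p.1 \in s /\ act x p.2 = v - p.1).
  by have [c cs [w _ E]] := sP v I; exists (c, w).
(* Two data locate [v]: its representative modulo [x W], and the colour modulo [Z] of a preimage of
   the remainder. *)
pose F v := (index (c v).1 s, f (c v).2).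
apply: (@covered_range _ (nat * 'I_n)%type F _ setT (`I_(size s).+1 `*` setT)).
- by apply: finite_setX; [apply: finite_II | apply: finite_finset].
- by move=> v _; split=> //=; rewrite ltnS index_size.
move=> v w _ _ [Ec Ef].
have [vs Ev] := Hc v; have [ws Ew] := Hc w.
have E1 : (c v).1 = (c w).1 by rewrite -(nth_index 0 vs) Ec nth_index.
exists ((c v).2 - (c w).2); first exact: fZ.
by rewrite actBr Ev Ew E1 opprB addrA subrK.
Qed.

(* Otherwise the images of suitable products of elements of g would give long  *)
(* descending chains of uniformly definable submodules of finite index.        *)
Lemma act_surjective x w : ~ almost_zero x -> exists v, torsion (w - act x v).
Proof.
move=> nx; have [//|nw] := EM (exists v, torsion (w - act x v)).
case: (@no_refinements (fun y a b => exists u, a = b + act y u) _ _ _ ex_not_almost_zeroT).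
- apply: (dpred_exs (p := sw)); apply: (dpred_eq (p := sw)); first exact: (dterm_var sw).
  apply: dterm_addW; first exact: (dterm_var sw).
  by apply: dterm_act; [apply: (dterm_var sg) | apply: (dterm_var sw)].
- move=> y; split=> [a|a b [u ->]|a b e [u ->] [v ->]].
  + by exists 0; rewrite act0r addr0.
  + by exists (- u); rewrite actNr addrK.
  + by exists (v + u); rewrite actDr addrA.
move=> m y ny.
(* The submodule [y x^n W]. Since [w] is outside [x W + W0], the elements [y x^j w] with [j < m]
   will be distinct modulo [y x^m W]. *)
pose Z n := [set act y (iter n (act x) u) | u in setT].
have Z_index : fin_index (Z m).
  have -> : Z m = [set act y z | z in iter m (fun Z' => [set act x z | z in Z']) setT].
    suff iE n : iter n (fun Z' => [set act x z | z in Z']) setT = range (iter n (act x)).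
      by rewrite iE image_comp.
    by elim: n => [|n IH] /=; rewrite ?image_id // IH image_comp.
  apply: image_index => //; elim: (m) => [|n IH] /=; last exact: image_index.
  by exists 1%N, (fun=> ord0).
have [s [_ sP]] := covered_reps Z_index.
(* The finitely many conditions [y' c] in [y x^m W] give all of [y' W] in [y x^m W]: if
   [u = c + y x^m v], then [y' u = y' c + y x^m (y' v)]. *)
have [|y' Hy' ny'] := @ex_not_almost_zero [set y' | forall c, c \in s -> Z m (act y' c)].
  apply: covered_seq => c _.
  have := covered_preim (actBl c) Z_index.
  exact: coveredS.
have y'Z u : exists v, act y' u = act y (iter m (act x) v).
  have [c cs [v _ E]] := sP u I; have [v' _ E'] := Hy' c cs.
  exists (v' + act y' v); rewrite iter_actD iter_actC actDr E' -(actC y') E actBr.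
  by rewrite addrC subrK.
exists y' => //; split=> [a b [u ->]|a].
  by have [v ->] := y'Z u; exists (iter m (act x) v).
(* If the elements for [j < l] agree modulo [y' W], then [y x^j] kills
   [w - x (x^(l-j-1) w + x^(m-j-1) v)]. This element is then torsion, against the choice of [w]. *)
exists (fun j => a + act y (iter j (act x) w)); split=> [j jm|j l jl lm [u]].
  by exists (- iter j (act x) w); rewrite actNr addrK.
have [v ->] := y'Z u; rewrite -addrA => /addrI /eqP; rewrite -actDr -subr_eq0 -actBr.
move=> /eqP E; case: nw.
exists (iter (l - j.+1) (act x) w + iter (m - j.+1) (act x) v).
apply: (@torsion_iter x j) => //; exists y => //; rewrite -[RHS]E; congr (act y _).
rewrite iter_actD iter_actN actDr iter_actD -!iterS -!iterD; congr (_ - (_ + _)).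
  by rewrite subnSK // subnKC // ltnW.
by rewrite subnSK ?subnKC // ?(ltn_trans jl) // ltnW // (ltn_trans jl).
Qed.

(** Some [x] outside [g0] sends the finitely many coset representatives, hence all of [W], into [Z];
    and [x] is surjective modulo torsion. *)
Lemma fin_index_full (Z : set W) w : subgroup Z -> stable Z -> fin_index Z ->
  exists2 z, Z z & torsion (w - z).
Proof.
move=> sZ tZ fZ; have [s [_ sP]] := covered_reps fZ.
have [|x Zx nx] := @ex_not_almost_zero [set x | forall c, c \in s -> Z (act x c)].
  apply: covered_seq => c _; have := covered_preim (actBl c) fZ.
  exact: coveredS.
have [v Tv] := act_surjective w nx; exists (act x v) => //.
have [c cs Zvc] := sP v I; rewrite -(subrK c v) actDr.
by apply: subgroupD => //; [apply: tZ | apply: Zx].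
Qed.

Lemma definable_full (Z : set W) : subgroup Z -> stable Z -> definable_set cW Z ->
  ~ (Z `<=` torsion) -> forall w, exists2 z, Z z & torsion (w - z).
Proof.
move=> sZ tZ dZ nZ w; have [fZ|fZ] := minimal sZ tZ dZ; last exact: fin_index_full.
by case: nZ; apply: finite_stable_torsion.
Qed.

(** * Spans of finite families and their ranks *)

(** The sum of the subgroups [g v]. It is definable, with one variable over [g] for each [v], but
    need neither be stable nor contain the [v]. *)
Fixpoint span (vs : seq W) : set W :=
  if vs is v :: vs' then [set w | exists x u, span vs' u /\ w = act x v + u]
  else [set 0].

Lemma subgroup_span vs : subgroup (span vs).
Proof.
elim: vs => [|v vs [s0 sB]] /=; first by split=> [//|_ _ -> ->]; rewrite subr0.
split=> [|_ _ [x [u [su ->]]] [y [w [sw' ->]]]].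
  by exists 0, 0; rewrite act0l addr0.
by exists (x - y), (u - w); split; [apply: sB | rewrite actBl opprD addrACA].
Qed.

Lemma definable_span vs : definable_set cW (span vs).
Proof.
elim: vs => [|v vs IH]; first exact: definable_set1.
apply: definable_setW; apply: (dpred_exs (p := sg)); apply: (dpred_exs (p := sw)).
apply: dpred_and; first exact: (dpred_in_proj (p := sw) _ IH).
apply: (dpred_eq (p := sw)); first exact: (dterm_var sw).
apply: dterm_addW; last exact: (dterm_var sw).
by apply: dterm_act; [apply: (dterm_var sg) | apply: dterm_const].
Qed.

Lemma span_sub (N : set W) vs : subgroup N -> stable N ->
  (forall v, v \in vs -> N v) -> span vs `<=` N.
Proof.
move=> sN tN; elim: vs => [|v vs IH] Nvs w /=; first by move=> ->; case: sN.
move=> [x [u [su ->]]]; apply: subgroupD => //; first exact/tN/Nvs/mem_head.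
by apply: IH su => c cs; apply: Nvs; rewrite in_cons cs orbT.
Qed.

Lemma span_cons v vs : span vs `<=` span (v :: vs).
Proof. by move=> u su; exists 0, u; rewrite act0l add0r. Qed.

Lemma span_act x vs : span [seq act x v | v <- vs] = [set act x u | u in span vs].
Proof.
elim: vs => [|v vs IH] /=.
  by apply/predeqP => w; split=> [->|[_ -> <-]]; rewrite ?act0r //; exists 0; rewrite ?act0r.
apply/predeqP => w; split=> [[y [u []]]|[_ [y [u [su ->]]] <-]].
  rewrite IH => -[u' su' <-] ->; exists (act y v + u').
    by exists y, u'.
  by rewrite actDr actC.
exists y, (act x u); split; last by rewrite actDr actC.
by rewrite IH; exists u.
Qed.

Definition span_torsion vs : set W :=
  [set w | exists2 u, span vs u & torsion (w - u)].

Lemma subgroup_span_torsion vs : subgroup (span_torsion vs).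
Proof.
have [s0 sB] := subgroup_span vs; have [t0 tB] := subgroup_torsion.
split=> [|v w [v' sv Tv] [w' sw' Tw]]; first by exists 0; rewrite ?subr0.
exists (v' - w'); first exact: sB.
rewrite opprB [w' - v']addrC addrACA [- w + w']addrC -[w' - w]opprB.
exact: tB.
Qed.

Lemma definable_span_torsion vs : definable_set cW (span_torsion vs).
Proof.
apply: definable_setW.
apply: (@dpred_ext _ _ _ _ _ (fun x : unit -> g * W =>
   exists u, span vs u /\ torsion ((x tt).2 - u))).
  by move=> x; split=> [[u [su Tu]]|[u su Tu]]; exists u.
apply: (dpred_exs (p := sw)); apply: dpred_and.
  exact: (dpred_in_proj (p := sw) _ (definable_span vs)).
apply: (dpred_in (p := sw) definable_torsion).
by apply: dterm_subW; apply: (dterm_var sw).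
Qed.

Section MaximalSpan.
Variable dim : dim_function L.
Hypothesis dimP : is_dimension T dim.
Variable N : set W.
Hypotheses (sN : subgroup N) (tN : stable N) (TN : torsion `<=` N).

Lemma definable_setTW : definable_set cW setT.
Proof. by apply: definable_setW; apply: dpredT. Qed.

Lemma definable_setTg : definable_set cg setT.
Proof. by apply: definable_setg; apply: dpredT. Qed.

Lemma maximal_span : exists vs, (forall v, v \in vs -> N v) /\
  forall us, (forall u, u \in us -> N u) -> (rank dim cW (span us) <= rank dim cW (span vs))%N.
Proof.
pose P n := `[< exists vs, (forall v, v \in vs -> N v) /\ rank dim cW (span vs) = n >].
have exP : exists n, P n.
  by exists (rank dim cW (span [::])); apply/asboolP; exists [::].
have leP n : P n -> (n <= rank dim cW setT)%N.
  move=> /asboolP[vs [_ <-]]; apply: (rank_sub dimP MT) => //.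
    exact: definable_span.
  exact: definable_setTW.
case: (ex_maxnP exP leP) => n /asboolP[vs [Nvs <-]] max; exists vs; split=> // us Nus.
by apply: max; apply/asboolP; exists us.
Qed.

Variable vs : seq W.
Hypothesis Nvs : forall v, v \in vs -> N v.
Hypothesis vs_max : forall us, (forall u, u \in us -> N u) ->
  (rank dim cW (span us) <= rank dim cW (span vs))%N.

(** Adding [v] to [us] cannot raise the rank, so finitely many cosets of [span us] cover the larger
    span, and in particular [g v]. The family [us] is left free because images of [vs] will be used
    too. *)
Lemma maximal_span_index us v : (forall u, u \in us -> N u) ->
  (rank dim cW (span vs) <= rank dim cW (span us))%N -> N v ->
  fin_index [set y | span us (act y v)].
Proof.
move=> Nus us_max Nv.
have cov : covered (span us) (span (v :: us)).
  apply/(rank_covered dimP MT def_addW).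
  - exact: subgroup_span.
  - exact: subgroup_span.
  - exact: span_cons.
  - exact: definable_span.
  - exact: definable_span.
  apply: leq_trans us_max; apply: vs_max => u; rewrite in_cons => /orP[/eqP-> //|].
  exact: Nus.
apply: coveredS (covered_preim (actBl v) cov) => // y _.
by exists y, 0; rewrite addr0; split=> //; case: (subgroup_span us).
Qed.

Lemma rank_span_act x us : ~ almost_zero x ->
  (rank dim cW (span us) <= rank dim cW (span [seq act x u | u <- us]))%N.
Proof.
move=> nx; apply: (rank_le_finite_fibres dimP MT (p := sw) (q := sw) (f := act x)).
- exact: definable_span.
- exact: definable_span.
- by move=> u su; rewrite span_act; exists u.
- by apply: dterm_act; [apply: dterm_const | apply: (dterm_var sw)].
move=> w _; apply: (@covered_finite_set _ (ker x)); first exact: not_almost_zero_ker.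
exists 1%N, (fun=> ord0) => u v [_ /= xu] [_ /= xv] _.
by rewrite /ker /= actBr xu xv subrr.
Qed.

(** As [x] has finite fibres, the image of [vs] under [x] also spans a group of maximal rank. If
    [y (x v) = x u] with [u] in [span vs], then [x] kills [y v - u], which is therefore torsion. *)
Lemma maximal_span_torsion x v : ~ almost_zero x -> N (act x v) ->
  fin_index [set y | span_torsion vs (act y v)].
Proof.
move=> nx Nxv.
have Nus u : u \in [seq act x u | u <- vs] -> N u.
  by move=> /mapP[v' v's ->]; apply/tN/Nvs.
apply: coveredS (maximal_span_index Nus (rank_span_act vs nx) Nxv) => // y.
rewrite /= span_act actC => -[u su xu].
by exists u => //; exists x => //; rewrite actBr xu subrr.
Qed.

Hypothesis nN : ~ (N `<=` torsion).

Lemma span_torsion_sub : span_torsion vs `<=` N.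
Proof.
move=> w [u /(span_sub sN tN Nvs) Nu /TN Nwu].
by rewrite -(subrK u w); apply: subgroupD.
Qed.

Lemma span_torsion_ann v : fin_index [set y | span_torsion vs (act y v)].
Proof.
(* [N] may fail to be definable, but [U] is: by maximality, [N] can be replaced by [span_torsion vs]
   in its definition. *)
pose U := [set v | exists2 x, ~ almost_zero x & N (act x v)].
have UP v' : U v' <-> exists x, ~ almost_zero x /\ span_torsion vs (act x v').
  split=> [[x nx /(maximal_span_torsion nx)/ex_not_almost_zero[y Vy ny]]|[x [nx Vx]]].
    by exists y.
  by exists x => //; apply: span_torsion_sub.
have [x0 nx0] := ex_not_almost_zeroT.
have NU : N `<=` U by move=> w Nw; exists x0 => //; apply: tN.
have sU : subgroup U.
  split=> [|v1 v2 [x1 n1 N1] [x2 n2 N2]]; first by apply: NU; case: sN.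
  have [y [V1 V2] ny] := ex_not_almost_zero
    (coveredI (maximal_span_torsion n1 N1) (maximal_span_torsion n2 N2)).
  apply/UP; exists y; split=> //; rewrite actBr.
  by case: (subgroup_span_torsion vs) => _; apply.
have tU : stable U by move=> y w [x nx Nx]; exists x => //; rewrite actC; apply: tN.
have dU : definable_set cW U.
  apply: definable_setW; apply: dpred_ext (fun x => iff_sym (UP _)) _.
  apply: (dpred_exs (p := sg)); apply: dpred_and.
    by apply: dpred_not; apply: (dpred_in_proj (p := sg) _ definable_almost_zero).
  apply: (dpred_in (p := sw) (definable_span_torsion vs)).
  by apply: dterm_act; [apply: (dterm_var sg) | apply: (dterm_var sw)].
have nU : ~ (U `<=` torsion) by move=> UT; apply: nN; apply: subset_trans UT.
have [z Uz Tvz] := definable_full sU tU dU nU v.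
have [x nx Nxv] : U v by rewrite -(subrK z v); apply: subgroupD => //; apply/NU/TN.
exact: maximal_span_torsion nx Nxv.
Qed.

(* Compare the two projections of the set of all (y, v) with y v in V.         *)
Lemma span_torsion_index : fin_index (span_torsion vs).
Proof.
set V := span_torsion vs; have dV := definable_span_torsion vs.
have sV := subgroup_span_torsion vs.
have [dTW dTg] := (definable_setTW, definable_setTg).
pose si : vsort cS (g * W) := sort_id cS.
pose E := [set s : g * W | V (act s.1 s.2)].
pose E1 := [set s : g * W | almost_zero s.1 /\ E s].
pose E2 := [set s : g * W | ~ almost_zero s.1 /\ E s].
have t1 : dterm sg (fun x : unit -> g * W => (x tt).1) by apply: (dterm_var sg).
have t2 : dterm sw (fun x : unit -> g * W => (x tt).2) by apply: (dterm_var sw).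
have dE : definable_set cS E.
  by apply/dpred_set; apply: (dpred_in (p := sw) dV); apply: dterm_act.
have dE1 : definable_set cS E1.
  apply/dpred_set; apply: dpred_and; last exact/dpred_set.
  exact: (dpred_in (p := sg) definable_almost_zero).
have dE2 : definable_set cS E2.
  apply/dpred_set; apply: dpred_and; last exact/dpred_set.
  by apply: dpred_not; apply: (dpred_in (p := sg) definable_almost_zero).
(* The fibre over each [v] is a subgroup of finite index in [g], hence of full rank. *)
have E_ge : (rank dim cW setT + rank dim cg setT <= rank dim cS E)%N.
  apply: (rank_ge_fibres dimP MT (p := si) (q := sw) (f := snd)) => //.
  - by exists 0.
  - by move=> v _; exists (0, v); split=> //; rewrite /E /= act0l; case: sV.
  move=> v _; pose C := [set y | V (act y v)].
  have dC : definable_set cg C.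
    apply: definable_setg; apply: (dpred_in (p := sw) dV).
    by apply: dterm_act => //; apply: dterm_const.
  have sC : subgroup C.
    split=> [|x y]; rewrite /C /= ?act0l; first by case: sV.
    by rewrite actBl; case: sV => _; apply.
  have CT : (rank dim cg setT <= rank dim cg C)%N.
    apply/(rank_covered dimP MT def_addg) => //.
    exact: span_torsion_ann.
  apply: leq_trans CT _.
  apply: (rank_le_finite_fibres dimP MT (p := sg) (q := si) (f := fun y => (y, v))) => //.
  - exact: (definable_set_fibre (p := si) (q := sw) (f := snd) dE t2).
  - apply: dpred_ext (dpred_and (dpred_eq (dterm_var sg None) (dterm_var sg (Some tt)))
      (dpred_eq (dterm_var sw None) (dterm_const sw _ v))) => x /=.
    by split=> [[<- <-]|->] //; case: (x None).
  - move=> s _; apply: sub_finite_set (finite_set1 s.1) => y [_ /= <-] //.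
have E1_le : (rank dim cS E1 <= rank dim cg almost_zero + rank dim cW setT)%N.
  apply: (rank_le_fibres dimP MT (p := si) (q := sg) (f := fst)) => //.
  - exact: definable_almost_zero.
  - by move=> s [].
  move=> y _; apply: (rank_le_finite_fibres dimP MT (p := si) (q := sw) (f := snd)) => //.
    exact: (definable_set_fibre (p := si) (q := sg) (f := fst) dE1 t1).
  by move=> w _; apply: sub_finite_set (finite_set1 (y, w)) => -[a b] [[_ /= <-] /= <-].
(* The fibre over [y] outside [g0] is mapped into [V] by [y] with finite fibres. Over the other [y]
   the fibre is empty. *)
have E2_le : (rank dim cS E2 <= rank dim cg setT + rank dim cW V)%N.
  apply: (rank_le_fibres dimP MT (p := si) (q := sg) (f := fst)) => //.
  move=> y _; apply: (rank_le_finite_fibres dimP MT (p := si) (q := sw)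
    (f := fun s => act s.1 s.2)) => //.
  - exact: (definable_set_fibre (p := si) (q := sg) (f := fst) dE2 t1).
  - by move=> s [[_]].
  - exact: dterm_act.
  move=> w _; have [ay|ny] := EM (almost_zero y).
    by apply: sub_finite_set (@finite_set0 _) => -[a b] [[[na _] /= ay']]; case: na; rewrite /= ay'.
  apply: (@sub_finite_set _ _ [set (y, v) | v in [set v | act y v = w]]).
    by move=> [a b] [[_ /= <-] /= abw]; exists b.
  apply: finite_image; apply: (@covered_finite_set _ (ker y)); first exact: not_almost_zero_ker.
  exists 1%N, (fun=> ord0) => u v /= yu yv _.
  by rewrite /ker /= actBr yu yv subrr.
have az_lt : (rank dim cg almost_zero < rank dim cg setT)%N.
  rewrite ltnNge; apply/negP => /(rank_covered dimP MT def_addg) h.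
  apply: almost_zero_index; apply: h => //; first exact: subgroup_almost_zero.
  exact: definable_almost_zero.
apply/(rank_covered dimP MT def_addW) => //.
have EU : E = E1 `|` E2.
  apply/predeqP => s; split=> [Es|[[]|[]] //].
  by have [?|?] := EM (almost_zero s.1); [left|right].
(* [E1] is too small to have the rank of [E], as [g0] has smaller rank than [g]. So [E2] has it, and
   rank [W] is at most rank [V]. *)
move: E_ge; rewrite EU (rankU dimP MT dE1 dE2) leq_max => /orP[h|h].
  have := leq_trans h E1_le; rewrite addnC leq_add2r leqNgt.
  by rewrite az_lt.
by have := leq_trans h E2_le; rewrite addnC leq_add2l.
Qed.

End MaximalSpan.

Lemma stable_index (N : set W) : subgroup N -> stable N -> torsion `<=` N ->
  ~ (N `<=` torsion) ->
  exists vs, (forall v, v \in vs -> N v) /\ fin_index (span_torsion vs).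
Proof.
move=> sN tN TN nN; have [dim dimP] := hT.
have [vs [Nvs vs_max]] := maximal_span dimP N.
by exists vs; split=> //; apply: (span_torsion_index dimP sN tN TN Nvs vs_max nN).
Qed.

Lemma stable_full (N : set W) : subgroup N -> stable N -> torsion `<=` N ->
  ~ (N `<=` torsion) -> N = setT.
Proof.
move=> sN tN TN nN; have [vs [Nvs /coveredS fN]] := stable_index sN tN TN nN.
apply/predeqP => w; split=> // _.
have [|z Nz /TN Nwz] := @fin_index_full N w sN tN.
  by apply: fN => // u; apply: span_torsion_sub.
by rewrite -(subrK z w); apply: subgroupD.
Qed.

(** * The field structure on the quotient by the torsion *)

(** The ring [R], kept as a set of maps on [W] rather than on the quotient, so that each of its
    elements is a definable term. *)
Inductive opring : (W -> W) -> Prop :=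
  | opring_id : opring id
  | opring_sub r s : opring r -> opring s -> opring (fun w => r w - s w)
  | opring_act x r : opring r -> opring (fun w => act x (r w)).

Lemma opring0 : opring (fun=> 0).
Proof.
by have := opring_sub opring_id opring_id; congr opring; apply/funext => w; rewrite subrr.
Qed.

Lemma opringD r s : opring r -> opring s -> opring (fun w => r w + s w).
Proof.
move=> hr hs; have := opring_sub hr (opring_sub opring0 hs).
by congr opring; apply/funext => w; rewrite sub0r opprK.
Qed.

Lemma opring_comp r s : opring r -> opring s -> opring (r \o s).
Proof.
move=> hr hs; elim: r / hr => [//|r r' _ IH _ IH'|x r _ IH].
  exact: (opring_sub IH IH').
exact: opring_act IH.
Qed.

Lemma opringB r : opring r -> {morph r : v w / v - w}.
Proof.
move=> hr; elim: r / hr => [//|r r' _ IH _ IH'|x r _ IH] v w.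
  by rewrite IH IH' !opprB [r' w - r' v]addrC addrACA [- r w + _]addrC.
by rewrite IH actBr.
Qed.

Lemma opring0r r : opring r -> r 0 = 0.
Proof. by move=> hr; rewrite -[in LHS](subrr 0) opringB // subrr. Qed.

Lemma opringDr r : opring r -> {morph r : v w / v + w}.
Proof.
move=> hr v w; rewrite -{1}[w]opprK opringB // -[- w]sub0r opringB // opring0r //.
by rewrite sub0r opprK.
Qed.

Lemma opring_actC r x w : opring r -> r (act x w) = act x (r w).
Proof.
move=> hr; elim: r / hr => [//|r r' _ IH _ IH'|y r _ IH]; first by rewrite IH IH' actBr.
by rewrite IH actC.
Qed.

Lemma opringC r s w : opring r -> opring s -> r (s w) = s (r w).
Proof.
move=> hr hs; elim: r / hr => [//|r r' _ IH _ IH'|y r _ IH].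
  by rewrite IH IH' opringB.
by rewrite IH opring_actC.
Qed.

Lemma opring_torsion r w : opring r -> torsion w -> torsion (r w).
Proof. by move=> hr [x nx xw]; exists x => //; rewrite -opring_actC // xw opring0r. Qed.

Lemma dterm_opring r (I : finType) (t : (I -> g * W) -> W) :
  opring r -> dterm sw t -> dterm sw (fun x => r (t x)).
Proof.
move=> hr dt; elim: r / hr => [//|r s _ IH _ IH'|y r _ IH]; first exact: dterm_subW.
by apply: dterm_act => //; apply: dterm_const.
Qed.

(** The elements of [R w], up to torsion, form a submodule that contains the torsion and the
    nontorsion element [w], hence all of [W]. *)
Lemma opring_generates w u : ~ torsion w -> exists2 r, opring r & torsion (u - r w).
Proof.
move=> nw; pose N := [set u | exists2 r, opring r & torsion (u - r w)].
have [T0 TB] := subgroup_torsion.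
suff /predeqP/(_ u)[_] : N = setT by apply.
apply: stable_full.
- split=> [|u1 u2 [r1 hr1 T1] [r2 hr2 T2]].
    by exists (fun=> 0); [apply: opring0 | rewrite subr0].
  exists (fun v => r1 v - r2 v); first exact: opring_sub.
  have -> : u1 - u2 - (r1 w - r2 w) = u1 - r1 w - (u2 - r2 w); last exact: TB.
  by rewrite !opprB [r2 w - r1 w]addrC addrACA [- u2 + _]addrC.
- move=> x v [r hr Tv]; exists (fun v => act x (r v)); first exact: opring_act.
  by rewrite -actBr; apply: stable_torsion.
- by move=> v Tv; exists (fun=> 0); [apply: opring0 | rewrite subr0].
- by move=> NT; apply: nw; apply: NT; exists id; [apply: opring_id | rewrite subrr].
Qed.

(** Up to torsion [v] is [s w] with [s] in [R], and [r] commutes with [s]. So an element of [R] is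
    determined modulo torsion by its value at a single nontorsion [w]. *)
Lemma opring_faithful w r v : ~ torsion w -> opring r -> torsion (r w) -> torsion (r v).
Proof.
move=> nw hr Trw; have [s hs Tv] := opring_generates v nw.
rewrite -(subrK (s w) v) opringDr //.
apply: subgroupD; first exact: subgroup_torsion.
  exact: opring_torsion.
by rewrite opringC //; apply: opring_torsion.
Qed.

Section Field.
Variables (w1 : W) (tW : zmodClosed W).
Hypotheses (nw1 : ~ torsion w1) (tWE : [set` tW] = torsion).

Local Notation Q := {quot tW}.

Lemma piWE u v : \pi_Q u = \pi_Q v <-> torsion (u - v).
Proof. by rewrite -tWE; apply: quot_eqE. Qed.

Lemma ex_coef : exists rho : W -> W -> W, forall u, opring (rho u) /\ torsion (u - rho u w1).
Proof.
have [u|rho rhoP] := @choice W (W -> W) (fun u r => opring r /\ torsion (u - r w1)).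
  by have [r] := opring_generates u nw1; exists r.
by exists rho.
Qed.

Variable rho : W -> W -> W.
Hypothesis rhoP : forall u, opring (rho u) /\ torsion (u - rho u w1).

(** The product of [r w1] and [v] is to be [r v]. Here [rho] chooses some [r]; [mulqE] says that any
    other one gives the same product. *)
Definition mulq (a b : Q) : Q := \pi_Q (rho (repr a) (repr b)).

Lemma mulqE r u v : opring r -> \pi_Q u = \pi_Q (r w1) ->
  mulq (\pi_Q u) (\pi_Q v) = \pi_Q (r v).
Proof.
move=> hr ur; have [ha Ta] := rhoP (repr (\pi_Q u)).
have [T0 TB] := subgroup_torsion.
set a := repr (\pi_Q u) in ha Ta *; set b := repr (\pi_Q v).
have Tb : torsion (v - b) by apply/piWE; rewrite reprK.
have Trw : torsion (r w1 - rho a w1).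
  have /piWE Tra : \pi_Q (r w1) = \pi_Q a by rewrite reprK.
  by rewrite -(subrK a (r w1)) -addrA; apply: subgroupD => //; apply: subgroup_torsion.
apply/esym/piWE; have := opring_faithful v nw1 (opring_sub hr ha) Trw.
move=> /= Trv; rewrite -(subrK (rho a v) (r v)) -addrA -opringB //.
by apply: subgroupD => //; apply: opring_torsion.
Qed.

Lemma mulq_rep (a : Q) : exists2 r, opring r & a = \pi_Q (r w1).
Proof.
have [hr Tr] := rhoP (repr a); exists (rho (repr a)) => //.
by rewrite -[LHS]reprK; apply/piWE.
Qed.

Lemma mulq_repE r v : opring r -> mulq (\pi_Q (r w1)) (\pi_Q v) = \pi_Q (r v).
Proof. by move=> hr; apply: mulqE. Qed.

Lemma quot_field : exists (K : fieldType) (f : {additive Q -> K}),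
  bijective f /\ forall r v, opring r -> f (\pi_Q (r v)) = f (\pi_Q (r w1)) * f (\pi_Q v).
Proof.
have mA : associative mulq.
  move=> a b c; have [r hr ->] := mulq_rep a; have [s hs ->] := mulq_rep b.
  have [t ht ->] := mulq_rep c; rewrite !mulq_repE //.
  by rewrite (mulq_repE _ (opring_comp hr hs)).
have mC : commutative mulq.
  move=> a b; have [r hr ->] := mulq_rep a; have [s hs ->] := mulq_rep b.
  by rewrite !mulq_repE // opringC.
have m1 : left_id (\pi_Q w1) mulq.
  by move=> a; have [r hr ->] := mulq_rep a; rewrite (mulq_repE _ opring_id).
have mD : left_distributive mulq +%R.
  move=> a b c; rewrite ![mulq _ c]mC; have [r hr ->] := mulq_rep c.
  rewrite -[a]reprK -[b]reprK -raddfD !mulq_repE // -raddfD.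
  by rewrite opringDr.
have e0 : \pi_Q w1 != 0.
  by apply/eqP; rewrite -(raddf0 \pi_Q) => /piWE; rewrite subr0.
have [a|inv0 inv0P] := @choice Q Q (fun a b => a != 0 -> mulq b a = \pi_Q w1).
  have [->|a0] := eqVneq a 0; first by exists 0.
  have [r hr aE] := mulq_rep a.
  have nr : ~ torsion (r w1).
    by move=> Tr; move: a0; rewrite aE -(raddf0 \pi_Q) => /eqP[]; apply/piWE; rewrite subr0.
  (* The vector [r w1] also generates: [s (r w1) = w1] modulo torsion, so [s w1] is the inverse of
     [r w1]. *)
  have [s hs Ts] := opring_generates w1 nr.
  by exists (\pi_Q (s w1)) => _; rewrite aE mulq_repE //; apply/esym/piWE.
pose inv a := if a == 0 then 0 else inv0 a.
have invP a : a != 0 -> mulq (inv a) a = \pi_Q w1.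
  by rewrite /inv => a0; rewrite (negPf a0); apply: inv0P.
have inv00 : inv 0 = 0 by rewrite /inv eqxx.
have [K [f [bf fM]]] := ops_fieldP mA mC m1 mD e0 invP inv00.
by exists K, f; split=> // r v hr; rewrite -fM mulq_repE.
Qed.

(** * Definability of the multiplication *)

(** Here [a] is a sum of terms [x v] and [c = r b], where [r] is the sum of the [x (rho v)], so that
    [r w1 = a] modulo torsion. Only the coefficients [x] vary, which makes the relation definable;
    [c] is determined by [a] and [b] up to torsion. *)
Fixpoint act_graph (vs : seq W) (b a c : W) : Prop :=
  if vs is v :: vs' then exists x a' c',
    [/\ act_graph vs' b a' c', a = act x v + a' & c = act x (rho v b) + c']
  else a = 0 /\ c = 0.

Lemma act_graph_opring vs b a c : act_graph vs b a c ->
  exists2 r, opring r & torsion (a - r w1) /\ c = r b.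
Proof.
have sT := subgroup_torsion; have [T0 _] := sT.
elim: vs a c => [|v vs IH] a c /=.
  by move=> [-> ->]; exists (fun=> 0); [apply: opring0 | rewrite subr0].
move=> [x [a' [c' [/IH[r hr [Tr ->]] -> ->]]]].
have [hv Tv] := rhoP v.
exists (fun w => act x (rho v w) + r w); first exact: opringD (opring_act x hv) hr.
split=> //; rewrite opprD addrACA -actBr.
by apply: subgroupD => //; apply: stable_torsion.
Qed.

Lemma span_act_graph vs b a : span vs a -> exists c, act_graph vs b a c.
Proof.
elim: vs a => [|v vs IH] a /=; first by move=> ->; exists 0.
move=> [x [u [/IH[c Hc] ->]]]; exists (act x (rho v b) + c).
by exists x, u, c.
Qed.

Lemma dpred_act_graph vs (I : finType) (tb ta tc : (I -> g * W) -> W) :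
  dterm sw tb -> dterm sw ta -> dterm sw tc ->
  dpred cS (fun x => act_graph vs (tb x) (ta x) (tc x)).
Proof.
elim: vs I tb ta tc => [|v vs IH] I tb ta tc db da dc /=.
  by apply: dpred_and; apply: (dpred_eq (p := sw)) => //; apply: dterm_const.
apply: (dpred_exs (p := sg)); apply: (dpred_exs (p := sw)); apply: (dpred_exs (p := sw)).
have up t : dterm sw t ->
    dterm sw (fun x : option (option (option I)) -> g * W => t (x \o Some \o Some \o Some)).
  by move=> dt; do 3 apply: dterm_comp.
pose P (x : option (option (option I)) -> g * W) :=
  act_graph vs (tb (x \o Some \o Some \o Some)) (x (Some None)).2 (x None).2 /\
  (ta (x \o Some \o Some \o Some) = act (x (Some (Some None))).1 v + (x (Some None)).2 /\
   tc (x \o Some \o Some \o Some) =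
     act (x (Some (Some None))).1 (rho v (tb (x \o Some \o Some \o Some))) + (x None).2).
apply: (@dpred_ext _ _ _ _ _ P) => [x|]; first by split=> [[? []]|[]].
apply: dpred_and; first by apply: IH; [apply: up|apply: (dterm_var sw)..].
apply: dpred_and; apply: (dpred_eq (p := sw)); do ?exact: up.
  apply: dterm_addW; last exact: (dterm_var sw).
  by apply: dterm_act; [apply: (dterm_var sg) | apply: dterm_const].
apply: dterm_addW; last exact: (dterm_var sw).
apply: dterm_act; first exact: (dterm_var sg).
by have [hv _] := rhoP v; apply: dterm_opring => //; apply: up.
Qed.

Lemma definable_mulq : dpred cS (fun x : option bool -> g * W =>
  \pi_Q (x None).2 = mulq (\pi_Q (x (Some true)).2) (\pi_Q (x (Some false)).2)).
Proof.
have [T0 TB] := subgroup_torsion.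
have [vs [_ Vs]] : exists vs, (forall v, v \in vs -> setT v) /\ fin_index (span_torsion vs).
  by apply: stable_index => // /(_ w1 I).
have [s [_ sP]] := covered_reps Vs.
(* The first factor is [c0 + a] modulo torsion, with [c0] among the finitely many representatives
   and [a] in [span vs]; it acts as [rho c0 + r], with [r] the operator that [act_graph] attaches to
   [a]. *)
pose P (c0 : W) (x : option bool -> g * W) := exists a c,
  act_graph vs (x (Some false)).2 a c /\
  (torsion ((x (Some true)).2 - c0 - a) /\
   torsion ((x None).2 - (rho c0 (x (Some false)).2 + c))).
have PE c0 u a v c : act_graph vs v a c -> torsion (u - c0 - a) ->
    mulq (\pi_Q u) (\pi_Q v) = \pi_Q (rho c0 v + c).
  move=> /act_graph_opring[r hr [Tr ->]] Tu; have [h0 Tc0] := rhoP c0.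
  apply: (@mulqE (fun w => rho c0 w + r w)); first exact: opringD.
  apply/piWE.
  have -> : u - (rho c0 w1 + r w1) = (u - c0 - a) + ((c0 - rho c0 w1) + (a - r w1)).
    by rewrite [c0 - _ + _]addrACA -!opprD -[u - c0 - a]addrA -opprD addrA subrK.
  by apply: subgroupD => //; apply: subgroupD.
apply: (@dpred_ext _ _ _ _ _ (fun x => exists2 c0, c0 \in s & P c0 x)).
  move=> x; split.
    move=> [c0 _ [a [c [Gac [Tu Tz]]]]].
    by rewrite (PE _ _ _ _ _ Gac Tu); apply/piWE.
  have [c0 c0s [a sa Ta]] := sP (x (Some true)).2 I.
  have [c Gac] := span_act_graph (x (Some false)).2 sa.
  by rewrite (PE _ _ _ _ _ Gac Ta) => /piWE Tz; exists c0 => //; exists a, c.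
apply: dpred_seq => c0.
apply: (dpred_exs (p := sw)); apply: (dpred_exs (p := sw)).
apply: dpred_and; first by apply: dpred_act_graph; apply: (dterm_var sw).
have [h0 _] := rhoP c0.
apply: dpred_and; apply: (dpred_in (p := sw) definable_torsion).
  apply: dterm_subW; last exact: (dterm_var sw).
  by apply: dterm_subW; [apply: (dterm_var sw) | apply: dterm_const].
apply: dterm_subW; first exact: (dterm_var sw).
apply: dterm_addW; last exact: (dterm_var sw).
by apply: dterm_opring => //; apply: (dterm_var sw).
Qed.

End Field.

Lemma no_quot_submodule (tW : zmodClosed W) : [set` tW] = torsion ->
  forall N : zmodClosed {quot tW}, quot_submodule act N ->
    [set` N] = [set 0] \/ [set` N] = setT.
Proof.
move=> tWE N hN; pose N' := [set w | \pi_{quot tW} w \in N].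
have piT w : \pi_{quot tW} w = 0 <-> torsion w.
  by rewrite -(raddf0 \pi_{quot tW}) (piWE tWE) subr0.
have sN : subgroup N'.
  split=> [|v w]; rewrite /N' /= ?raddf0 ?rpred0 // raddfB; exact: rpredB.
have tN : stable N' by move=> x w; apply: hN.
have TN : torsion `<=` N' by move=> w /piT; rewrite /N' /= => ->; rewrite rpred0.
have [NT|nN] := EM (N' `<=` torsion); [left|right].
  apply/predeqP => a; split=> [Na|->]; last by rewrite /= rpred0.
  by rewrite -[a]reprK; apply/piT/NT; rewrite /N' /= reprK.
have NE := stable_full sN tN TN nN; apply/predeqP => a; split=> // _.
by have : N' (repr a) by [rewrite NE]; rewrite /N' /= reprK.
Qed.

(** * Assembling the field, the submodule and the ideal *)

Lemma field_of_module :
  exists (K : fieldType) (cK : coding M K)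
    (W0 : zmodClosed W) (g0 : zmodClosed g)
    (psi : {additive {quot W0} -> K}) (sigma : {additive {quot g0} -> K}),
    [/\ definable_op cK cK cK +%R /\ definable_op cK cK cK *%R,
        submodule act W0 /\ finite_set [set` W0],
        bijective psi /\
          definable_map cW cK (fun w => psi (\pi_{quot W0} w)),
        definable_set cg [set` g0] /\ ~ finite_index [set` g0]
      & injective sigma /\
          forall x w, psi (\pi_{quot W0} (act x w)) =
                      sigma (\pi_{quot g0} x) * psi (\pi_{quot W0} w)]
    /\ forall N : zmodClosed {quot W0}, quot_submodule act N ->
         [set` N] = [set 0] \/ [set` N] = setT.
Proof.
have [tW tWE] := subgroup_zmodClosed subgroup_torsion.
have [tg tgE] := subgroup_zmodClosed subgroup_almost_zero.
have [w1 nw1] := ex_not_torsion; have [rho rhoP] := ex_coef nw1.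
have [K [psi [bpsi psiM]]] := quot_field nw1 tWE rhoP.
have inj_psi : injective psi by apply: bij_inj.
pose q w := psi (\pi_{quot tW} w).
have qE u v : q u = q v <-> torsion (u - v).
  by rewrite -(piWE tWE); split=> [/inj_psi|]; rewrite /q => ->.
have q_surj k : exists w, q w = k.
  by have [psi' _ psiK] := bpsi; exists (repr (psi' k)); rewrite /q reprK.
have dq : dpred (sort_coding sw) (fun x : bool -> W => q (x true) = q (x false)).
  pose si := sort_id cW.
  have dT := dpred_in (p := si) definable_torsion
    (dterm_sub (p := si) def_addW (dterm_var si true) (dterm_var si false)).
  by apply: dpred_ext dT => x; rewrite qE.
pose sK : vsort cS K := sort_quot q_surj dq.
exists K, (sort_coding sK), tW, tg, psi.
(* An [x] outside [g0] is injective modulo torsion, so the single vector [w1] decides whether [x] is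
   almost zero. *)
have piT x : almost_zero x <-> torsion (act x w1).
  split=> [/almost_zeroP //|Tx]; have [//|nx] := EM (almost_zero x).
  by case: nw1; apply: torsion_act Tx.
(* Since [w1] becomes the unit of [K], the scalar by which [x] acts is its value at [w1]. *)
pose sigma (a : {quot tg}) : K := q (act (repr a) w1).
have sigmaE x : sigma (\pi_{quot tg} x) = q (act x w1).
  apply/qE; rewrite -actBl; apply/piT; rewrite -tgE; apply/quot_eqE.
  exact: reprK.
have sigmaB : zmod_morphism sigma.
  move=> a b; rewrite -[a]reprK -[b]reprK -raddfB !sigmaE.
  by rewrite actBl /q !raddfB.
pose Sigma : {additive {quot tg} -> K} := HB.pack sigma
  (GRing.isZmodMorphism.Build {quot tg} K sigma sigmaB).
exists Sigma; split; last exact: no_quot_submodule.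
split.
- split.
    apply: definable_op_proj.
    apply: (@dpred_ext _ _ _ _ _ (fun x : option bool -> g * W =>
      torsion ((x None).2 - ((x (Some true)).2 + (x (Some false)).2)))).
      by move=> x; rewrite -qE /= {2}/q !raddfD.
    apply: (dpred_in (p := sw) definable_torsion).
    apply: dterm_subW; first exact: (dterm_var sw).
    by apply: dterm_addW; apply: (dterm_var sw).
  apply: definable_op_proj; apply: dpred_ext (definable_mulq nw1 tWE rhoP) => x /=.
  have [r hr E] := mulq_rep tWE rhoP (\pi_{quot tW} (x (Some true)).2).
  rewrite /q E -psiM // (mulqE nw1 tWE rhoP _ hr) //.
  by split=> [->|/inj_psi].
- split; last by rewrite tWE; apply: finite_torsion.
  move=> x w wT; have : [set` tW] w by [].
  by rewrite tWE => /(stable_torsion x); rewrite -tWE.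
- split=> //; have dW := definable_setTW.
  have := sort_graph (p := sw) (q := sK) (f := q) dW (dterm_var sK tt).
  by apply: definable_ext => z; split=> [[w [_ ? ?]]|[w [? ?]]]; exists w.
- rewrite tgE; split; first exact: definable_almost_zero.
  by move=> /(finite_indexP subgroup_almost_zero); apply: almost_zero_index.
split=> [a b /= |x w].
  rewrite -[a]reprK -[b]reprK !sigmaE => /qE; rewrite -actBl => /piT.
  by rewrite -tgE => /quot_eqE.
rewrite /= sigmaE /q -psiM //; exact: opring_act opring_id.
Qed.

End MinimalModule.

Theorem lemma7p1 (L : signature) (T : set (sentence L))
    (hT : finite_dimensional T) (M : structure L) (hM : models M T)
    (g W : zmodType) (br : g -> g -> g) (act : g -> W -> W)
    (hg : lie_bracket br) (hW : lie_action br act)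
    (cg : coding M g) (cW : coding M W)
    (def_addg : definable_op cg cg cg +%R) (def_br : definable_op cg cg cg br)
    (def_addW : definable_op cW cW cW +%R) (def_act : definable_op cg cW cW act)
    (abelian_g : forall x y, br x y = 0)
    (minimal_W : minimal_module cW act)
    (nontrivial : ~ almost_trivial act) :
  exists (K : fieldType) (cK : coding M K)
    (W0 : zmodClosed W) (g0 : zmodClosed g)
    (psi : {additive {quot W0} -> K}) (sigma : {additive {quot g0} -> K}),
    [/\ definable_op cK cK cK +%R /\ definable_op cK cK cK *%R,
        submodule act W0 /\ finite_set [set` W0],
        bijective psi /\
          definable_map cW cK (fun w => psi (\pi_{quot W0} w)),
        [/\ lie_ideal br g0, definable_set cg [set` g0]
          & ~ finite_index [set` g0]]
      & injective sigma /\
          forall x w, psi (\pi_{quot W0} (act x w)) =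
                      sigma (\pi_{quot g0} x) * psi (\pi_{quot W0} w)]
    /\ forall N : zmodClosed {quot W0}, quot_submodule act N ->
         [set` N] = [set 0] \/ [set` N] = setT.
Proof.
have [[act_bi act_br] [br_bi _ _]] := (hW, hg).
have act0 w : act 0 w = 0 by apply: act0l.
have actC x y w : act x (act y w) = act y (act x w).
  by apply/eqP; rewrite -subr_eq0 -act_br abelian_g act0.
have [K [cK [W0 [g0 [psi [sigma [[opK subW0 psiP [dg0 ng0] sigmaP] simple]]]]]]] :=
  field_of_module hT hM act_bi actC def_addg def_addW def_act minimal_W nontrivial.
exists K, cK, W0, g0, psi, sigma; split=> //; split=> //; split=> //.
by move=> x y _; rewrite abelian_g rpred0.
Qed.
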